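(* Let $(M,g,\omega,J)$ be a Kähler-Einstein surface (complex dimension 2) with scalar curvature $s$, and at each point let $\lambda_{1}\leq\lambda_{2}\leq\lambda_{3}$ be the eigenvalues of $W^{-}$. Then at each point \[H_{max}=\frac{s}{6}+\frac{\lambda_{3}}{2},\qquad H_{min}=\frac{s}{6}+\frac{\lambda_{1}}{2},\qquad H_{av}=\frac{s}{6},\] where $H_{max}$ and $H_{min}$ are the maximum and the minimum of the holomorphic sectional curvature at the point, and $H_{av}$ is the average of the holomorphic sectional curvature at the point.
   Context: A Kähler surface is oriented by its complex structure. $\Lambda^{2}=\Lambda^{+}\oplus\Lambda^{-}$ is the decomposition into self-dual and anti-self-dual 2-forms, with $|e_i\wedge e_j|=1$ for an orthonormal coframe and $i\neq j$. The curvature is $R(X\wedge Y,Z\wedge W)=g(R(X,Y)W,Z)$ with $R(X,Y)Z=\nabla_X\nabla_YZ-\nabla_Y\nabla_XZ-\nabla_{[X,Y]}Z$, so that $R(X\wedge Y,X\wedge Y)$ is the sectional curvature for orthonormal $X,Y$. The $\Lambda^{\pm}$-diagonal blocks of the associated curvature operator are $W^{\pm}+\frac{s}{12}I$ with $W^{\pm}$ symmetric and trace-free. For a unit tangent vector $X$, the holomorphic sectional curvature is $H(X,JX)=R(X\wedge JX,X\wedge JX)$. The average at $p$ is $H_{av}(p)=\frac{1}{\mathrm{vol}(\mathbb{S}^{3})}\int_{S_p}H\,d\sigma$, where $S_p\subset T_pM$ is the unit sphere with its standard volume form $d\sigma$. *)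

(* Defs.v *)
From HB Require Import structures.
From mathcomp Require Import all_boot all_order all_algebra.
From mathcomp Require Import all_classical all_reals all_analysis.

Set Implicit Arguments.
Unset Strict Implicit.
Unset Printing Implicit Defensive.

Import Order.TTheory GRing.Theory Num.Theory.
Import numFieldNormedType.Exports.

Local Open Scope classical_set_scope.
Local Open Scope ring_scope.

(* Tangent vectors and points of R^4 are row vectors; matrices act on the
   right, so the row vector of an image under a linear map A is v *m A. *)

Definition coordvec (R : realType) (i : 'I_4) : 'rV[R]_4 := delta_mx 0 i.

Definition partial (R : realType) (i : 'I_4) (f : 'rV[R]_4 -> R) :
    'rV[R]_4 -> R :=
  fun x => 'D_(coordvec R i) f x.

(* Only meant for open U. *)
Fixpoint Ck (R : realType) (k : nat) (U : set 'rV[R]_4)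
    (f : 'rV[R]_4 -> R) : Prop :=
  match k with
  | 0 => forall x, U x -> {for x, continuous f}
  | k'.+1 => forall i : 'I_4,
      (forall x, U x -> derivable f x (coordvec R i)) /\ Ck k' U (partial i f)
  end.

Definition smooth_on (R : realType) (U : set 'rV[R]_4)
    (f : 'rV[R]_4 -> R) : Prop :=
  forall k, Ck k U f.

(* C^2 is R^4 with real coordinates (x1, y1, x2, y2), where z_k = x_k + i y_k:
   J0 maps d/dx_k to d/dy_k and d/dy_k to - d/dx_k. The standard orientation
   of R^4 in these coordinates is the one induced by J0. *)
Definition J0 (R : realType) : 'M[R]_4 :=
  \matrix_(i, j) if ~~ odd i && (j == i.+1 :> nat) then 1
                 else if odd i && (i == j.+1 :> nat) then -1 else 0.

(* Commutation of the Jacobian with J0 is the Cauchy-Riemann system. *)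
Definition holomorphic_on (R : realType) (U : set 'rV[R]_4)
    (f : 'rV[R]_4 -> 'rV[R]_4) : Prop :=
  (forall a : 'I_4, smooth_on U (fun x => f x 0 a)) /\
  (forall x, U x -> J0 R *m jacobian f x = jacobian f x *m J0 R).

(* chart_inv i is only meaningful on the image of the i-th chart. *)
Record complexSurface (R : realType) (M : topologicalType) := ComplexSurface {
  chart_index : Type;
  chart_dom : chart_index -> set M;
  chart_map : chart_index -> M -> 'rV[R]_4;
  chart_inv : chart_index -> 'rV[R]_4 -> M;
  surface_hausdorff : hausdorff_space M;
  surface_second_countable : @second_countable M;
  chart_dom_open : forall i, open (chart_dom i);
  chart_dom_cover : forall p, exists i, chart_dom i p;
  chart_image_open : forall i, open (chart_map i @` chart_dom i);
  chart_mapK : forall i p, chart_dom i p -> chart_inv i (chart_map i p) = p;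
  chart_map_continuous : forall i,
    {within chart_dom i, continuous (chart_map i)};
  chart_inv_continuous : forall i,
    {within chart_map i @` chart_dom i, continuous (chart_inv i)};
  chart_transition_holomorphic : forall i j,
    holomorphic_on (chart_map i @` (chart_dom i `&` chart_dom j))
      (chart_map j \o chart_inv i)
}.

(* The complex structure J is the constant matrix J0 in every chart. The metric
   is given by its Gram matrices (g(d_a, d_b)) in the charts; J0 *m g is the
   matrix of the Kaehler form omega(X, Y) = g(J X, Y). *)
Record kahlerMetric (R : realType) (M : topologicalType)
    (S : complexSurface R M) := KahlerMetric {
  metric : chart_index S -> 'rV[R]_4 -> 'M[R]_4;
  metric_smooth : forall i a b,
    smooth_on (chart_map i @` chart_dom i) (fun x => metric i x a b);
  metric_sym : forall i p, chart_dom i p ->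
    (metric i (chart_map i p))^T = metric i (chart_map i p);
  metric_pos : forall i p (v : 'rV[R]_4), chart_dom i p -> v != 0 ->
    0 < (v *m metric i (chart_map i p) *m v^T) 0 0;
  metric_compat : forall i j p, chart_dom i p -> chart_dom j p ->
    let A := jacobian (chart_map j \o chart_inv i) (chart_map i p) in
    metric i (chart_map i p) = A *m metric j (chart_map j p) *m A^T;
  metric_hermitian : forall i p, chart_dom i p ->
    J0 R *m metric i (chart_map i p) *m (J0 R)^T = metric i (chart_map i p);
  kahler_form_closed : forall i p, chart_dom i p ->
    let omega a b := fun x => (J0 R *m metric i x) a b in
    forall a b c : 'I_4,
      partial a (omega b c) (chart_map i p) +
      partial b (omega c a) (chart_map i p) +
      partial c (omega a b) (chart_map i p) = 0
}.

Section LocalGeometry.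
Context (R : realType).
Implicit Types (g : 'rV[R]_4 -> 'M[R]_4) (x : 'rV[R]_4) (X Y Z W : 'rV[R]_4).

(* In this section g is the matrix field of a metric on an open set of R^4. *)

Definition inner g x X Y : R := (X *m g x *m Y^T) 0 0.

(* christoffel g i j k is Gamma^k_ij of the Levi-Civita connection. *)
Definition christoffel g (i j k : 'I_4) x : R :=
  2^-1 * \sum_(l < 4) (invmx (g x)) k l *
    (partial i (fun y => g y j l) x + partial j (fun y => g y i l) x
     - partial l (fun y => g y i j) x).

(* Covariant derivative of the vector field V along d_i. *)
Definition nabla g (i : 'I_4) (V : 'rV[R]_4 -> 'rV[R]_4) :
    'rV[R]_4 -> 'rV[R]_4 :=
  fun x => \row_l (partial i (fun y => V y 0 l) x +
                   \sum_(k < 4) V x 0 k * christoffel g i k l x).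

(* R(d_i, d_j) d_k; the bracket [d_i, d_j] vanishes. *)
Definition riemann g (i j k : 'I_4) x : 'rV[R]_4 :=
  let dk := fun=> coordvec R k in
  nabla g i (nabla g j dk) x - nabla g j (nabla g i dk) x.

(* R(d_i /\ d_j, d_k /\ d_l) = g(R(d_i, d_j) d_l, d_k). *)
Definition curv g x (i j k l : 'I_4) : R :=
  inner g x (riemann g i j l x) (coordvec R k).

(* R(X /\ Y, Z /\ W). *)
Definition curvature g x X Y Z W : R :=
  \sum_(i < 4) \sum_(j < 4) \sum_(k < 4) \sum_(l < 4)
    X 0 i * Y 0 j * Z 0 k * W 0 l * curv g x i j k l.

(* Ric(Y, Z) is the trace of X |-> R(X, Y) Z. *)
Definition ricci g x : 'M[R]_4 :=
  \matrix_(j, k) \sum_(i < 4) riemann g i j k x 0 i.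

Definition scalar_curvature g x : R :=
  \sum_(j < 4) \sum_(k < 4) invmx (g x) j k * ricci g x j k.

(* 2-forms are skew-symmetric matrices (alpha(d_i, d_j)); sharp raises both
   indices. The inner product for which the e_i /\ e_j (i < j) of an orthonormal
   coframe are orthonormal is (1/2) \sum_ij alpha_ij (sharp beta)^ij. *)
Definition two_form (alpha : 'M[R]_4) : Prop := alpha^T = - alpha.

Definition sharp g x (alpha : 'M[R]_4) : 'M[R]_4 :=
  invmx (g x) *m alpha *m invmx (g x).

Definition levi_civita (i j k l : 'I_4) : R :=
  \det (\matrix_(a < 4, b < 4) (tnth [tuple i; j; k; l] a == b)%:R).

(* Hodge star for the orientation of J0, i.e. for the volume form
   sqrt(det g) dx1 /\ dy1 /\ dx2 /\ dy2. *)
Definition hodge g x (alpha : 'M[R]_4) : 'M[R]_4 :=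
  \matrix_(k, l) (2^-1 * Num.sqrt (\det (g x)) *
    \sum_(i < 4) \sum_(j < 4) levi_civita i j k l * sharp g x alpha i j).

Definition anti_self_dual g x (alpha : 'M[R]_4) : Prop :=
  two_form alpha /\ hodge g x alpha = - alpha.

(* The 2-form determined by <curvature_operator alpha, beta> =
   R(sharp alpha, sharp beta), where R is extended bilinearly to bivectors. *)
Definition curvature_operator g x (alpha : 'M[R]_4) : 'M[R]_4 :=
  \matrix_(k, l) (2^-1 *
    \sum_(i < 4) \sum_(j < 4) sharp g x alpha i j * curv g x i j k l).

Definition proj_asd g x (alpha : 'M[R]_4) : 'M[R]_4 :=
  2^-1 *: (alpha - hodge g x alpha).

(* W^-, meant as an endomorphism of the anti-self-dual 2-forms. *)
Definition weyl_minus g x (alpha : 'M[R]_4) : 'M[R]_4 :=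
  proj_asd g x (curvature_operator g x alpha)
  - (scalar_curvature g x / 12) *: alpha.

Definition asd_basis g x (b : 'I_3 -> 'M[R]_4) : Prop :=
  (forall a, anti_self_dual g x (b a)) /\
  (forall alpha, anti_self_dual g x alpha ->
     exists! c : 'rV[R]_3, alpha = \sum_(a < 3) c 0 a *: b a).

(* l1, l2, l3 are the eigenvalues of W^-, with multiplicity. *)
Definition weyl_minus_eigenvalues g x (l1 l2 l3 : R) : Prop :=
  exists (b : 'I_3 -> 'M[R]_4) (A : 'M[R]_3),
    [/\ asd_basis g x b,
        forall a, weyl_minus g x (b a) = \sum_(c < 3) A a c *: b c
      & char_poly A = ('X - l1%:P) * ('X - l2%:P) * ('X - l3%:P)].

Definition unit_vector g x X : Prop := inner g x X X = 1.

Definition hol_curv g x X : R :=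
  curvature g x X (X *m J0 R) X (X *m J0 R).

Definition hol_curv_values g x : set R := hol_curv g x @` unit_vector g x.

Definition orthonormal_frame g x (e : 'I_4 -> 'rV[R]_4) : Prop :=
  forall a b, inner g x (e a) (e b) = (a == b)%:R.

(* The point with spherical coordinates (psi, theta, phi) of the unit sphere,
   identified with S^3 by the orthonormal frame e. *)
Definition sphere_point (e : 'I_4 -> 'rV[R]_4) (psi theta phi : R) : 'rV[R]_4 :=
  \sum_(a < 4) tnth [tuple cos psi; sin psi * cos theta;
                     sin psi * sin theta * cos phi;
                     sin psi * sin theta * sin phi] a *: e a.

(* Integral over the unit sphere for its standard volume form, which is
   sin^2 psi sin theta dpsi dtheta dphi in spherical coordinates. *)
Definition sphere_integral (e : 'I_4 -> 'rV[R]_4) (f : 'rV[R]_4 -> R) : R :=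
  Rintegral lebesgue_measure `[0, pi] (fun psi : R =>
    Rintegral lebesgue_measure `[0, pi] (fun theta : R =>
      Rintegral lebesgue_measure `[0, 2 * pi] (fun phi : R =>
        f (sphere_point e psi theta phi) * (sin psi ^+ 2 * sin theta)))).

Definition hol_curv_average g x (e : 'I_4 -> 'rV[R]_4) : R :=
  (sphere_integral e (fun=> 1))^-1 * sphere_integral e (hol_curv g x).

End LocalGeometry.

Definition is_maximum (R : realType) (A : set R) (m : R) : Prop :=
  A m /\ ubound A m.

Definition is_minimum (R : realType) (A : set R) (m : R) : Prop :=
  A m /\ lbound A m.

Definition einstein (R : realType) (M : topologicalType)
    (S : complexSurface R M) (g : kahlerMetric S) : Prop :=
  exists c : R, forall i p, chart_dom i p ->
    ricci (metric g i) (chart_map i p) = c *: metric g i (chart_map i p).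

(* Main.v *)
(* A unit vector X satisfies X /\ JX = (omega + phi) / 2, where omega is the
   Kaehler form and phi is an anti-self-dual form of norm sqrt 2; X |-> phi is
   the Hopf map, so every such phi occurs. Since nabla J = 0, the curvature
   operator is J-invariant, and the Einstein condition kills the mixed term
   R(omega, phi), so H(X) = R(omega, omega) / 4 + R(phi, phi) / 4 =
   s / 8 + s / 24 + W^-(phi, phi) / 4. With phi = sqrt 2 times a unit vector
   this is s / 6 plus half the quadratic form of W^- on the unit sphere of
   Lambda^-, whose extrema are the extreme eigenvalues. For the average, the
   fourth moments of S^3 turn the mean of the quartic form H into 1/24 of its
   full contraction, which the Bianchi identity and J-invariance reduce to
   4 s. *)

Require Import Defs.
From HB Require Import structures.
From mathcomp Require Import all_boot all_order all_algebra.
From mathcomp Require Import all_classical all_reals all_analysis.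
From mathcomp Require Import ring lra.

Set Implicit Arguments.
Unset Strict Implicit.
Unset Printing Implicit Defensive.

Import Order.TTheory GRing.Theory Num.Theory.
Import numFieldNormedType.Exports.
Local Open Scope ring_scope.

(** * Symmetry of second derivatives *)

(** The analysis serves to obtain, at one point, a tensor with the symmetries of a Kähler curvature.
    Besides torsion-freeness two facts carry it: mixed partials of the metric commute, which makes
    the curvature skew in its last pair; and the Koszul expression of the lowered Christoffel
    symbols turns closedness of omega into commutation of the connection with [J0], which is
    constant in every chart. A matrix [P] with [P *m g x *m P^T = 1%:M] and [P *m J0 R = J0 R *m P]
    then makes the metric the identity while [J0] and the orientation stay put, so that what remains
    is polynomial identities in finitely many components. The eigenvalues are given only through the
    characteristic polynomial of a matrix [A] in an arbitrary basis of anti-self-dual forms. [A] is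
    similar to a symmetric matrix, whose quadratic form is bounded by Cayley-Hamilton and an
    explicit square root, without diagonalising. The average is taken in an arbitrary orthonormal
    frame, possibly unrelated to [J0]; orthogonal invariance of traces leads back to [P]. *)

Lemma subr_subACA (V : zmodType) (a b c d : V) :
  a - b - (c - d) = a - c - (b - d).
Proof. by rewrite !opprB addrACA [RHS]addrACA (addrC (- b)). Qed.

Lemma ler_dist_halves (R : realFieldType) (e p q z : R) :
  `|p - z| < e / 2 -> `|q - z| < e / 2 -> `|p - q| <= e.
Proof.
move=> pz qz; rewrite (_ : p - q = (p - z) - (q - z)); last by ring.
by have := ler_normB (p - z) (q - z); lra.
Qed.

Lemma is_derive_line (R : realType) (V : normedModType R) (f : V -> R)
    (x v : V) (t : R) : derivable f (x + t *: v) v ->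
  is_derive t 1 (fun s => f (x + s *: v)) ('D_v f (x + t *: v)).
Proof.
move=> df.
have E : (fun h => h^-1 *: (((fun s => f (x + s *: v)) \o shift t) (h *: 1) - f (x + t *: v)))
  = (fun h => h^-1 *: ((f \o shift (x + t *: v)) (h *: v) - f (x + t *: v))).
  apply/funext => h /=; congr (_ *: (f _ - _)).
  by rewrite [h *: 1]mulr1 scalerDl addrCA.
apply: DeriveDef; first by rewrite /derivable E; exact: df.
by rewrite /derive E.
Qed.

Lemma MVT_line (R : realType) (V : normedModType R) (f : V -> R) (x v : V)
    (h : R) : 0 < h -> (forall t, 0 <= t <= h -> derivable f (x + t *: v) v) ->
  exists2 c, 0 < c < h & f (x + h *: v) - f x = 'D_v f (x + c *: v) * h.
Proof.
move=> h0 df.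
have [||c] := @MVT R (fun s => f (x + s *: v)) (fun t => 'D_v f (x + t *: v)) 0 h h0.
- move=> t; rewrite in_itv /= => /andP[t0 th].
  by apply: is_derive_line; apply: df; rewrite !ltW.
- apply: derivable_within_continuous => t; rewrite in_itv /= => th.
  by have [] := is_derive_line (df t th).
rewrite in_itv /= => ch; rewrite subr0 scale0r addr0 => E.
by exists c.
Qed.

(** The mean value theorem twice: along [u] for the difference of [f] on the two sides of the
    parallelogram parallel to [u], then along [v] for ['D_u f]. *)
Lemma second_difference (R : realType) (V : normedModType R) (f : V -> R)
    (x u v : V) (h : R) : 0 < h ->
  (forall s t, 0 <= s <= h -> 0 <= t <= h ->
     derivable f (x + s *: u + t *: v) u /\
     derivable ('D_u f) (x + s *: u + t *: v) v) ->
  exists2 c : R * R, (0 < c.1 < h) && (0 < c.2 < h) &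
    f (x + h *: u + h *: v) - f (x + h *: v) - (f (x + h *: u) - f x) =
    'D_v ('D_u f) (x + c.1 *: u + c.2 *: v) * h * h.
Proof.
move=> h0 df.
have hh : 0 <= h <= h by rewrite lexx ltW.
have h00 : 0 <= (0:R) <= h by rewrite lexx ltW.
have d1 s t : 0 <= s <= h -> 0 <= t <= h ->
    is_derive s 1 (fun s => f (x + t *: v + s *: u)) ('D_u f (x + s *: u + t *: v)).
  move=> sh th; have [d _] := df s t sh th.
  by rewrite addrAC; apply: is_derive_line; rewrite addrAC.
pose phi s := f (x + h *: v + s *: u) - f (x + 0 *: v + s *: u).
pose dphi s := 'D_u f (x + s *: u + h *: v) - 'D_u f (x + s *: u + 0 *: v).
have dp s : 0 <= s <= h -> is_derive s 1 phi (dphi s).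
  move=> sh; apply: is_deriveB; exact: d1.
have [||c] := @MVT R phi dphi 0 h h0.
- move=> s; rewrite in_itv /= => /andP[s0 sh].
  by apply: dp; rewrite !ltW.
- apply: derivable_within_continuous => s; rewrite in_itv /= => sh.
  by have [] := dp s sh.
rewrite in_itv /= => ch; rewrite subr0 /phi /dphi !scale0r !addr0 => E.
have ch' : 0 <= c <= h by case/andP: ch => ? ?; rewrite !ltW.
have [d dh Ed] := @MVT_line R V ('D_u f) (x + c *: u) v h h0 (fun t th => (df c t ch' th).2).
exists (c, d); first by rewrite ch.
by rewrite /= -Ed -E (addrAC x (h *: u)) subr_subACA.
Qed.

(** Schwarz's theorem. The second difference over a parallelogram is symmetric in [u] and [v], so in
    every small one the two mixed derivatives take a common value, at different points; continuity
    at [x] concludes. *)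
Lemma derive_comm (R : realType) (V : normedModType R) (f : V -> R)
    (x u v : V) :
  (\forall y \near x, [/\ derivable f y u, derivable f y v,
     derivable ('D_u f) y v & derivable ('D_v f) y u]) ->
  {for x, continuous ('D_v ('D_u f))} -> {for x, continuous ('D_u ('D_v f))} ->
  'D_v ('D_u f) x = 'D_u ('D_v f) x.
Proof.
move=> df cvu cuv; apply/eqP; rewrite -subr_eq0 -normr_le0.
apply/ler_addgt0Pr => e e0; rewrite add0r.
have e2 : 0 < e / 2 by rewrite divr_gt0.
move/cvgrPdist_lt : cvu => /(_ _ e2) cvu.
move/cvgrPdist_lt : cuv => /(_ _ e2) cuv.
have /nbhs_ballP[d d0 H] : nbhs x (fun y => [/\ [/\ derivable f y u, derivable f y v,
     derivable ('D_u f) y v & derivable ('D_v f) y u],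
     `|'D_v ('D_u f) x - 'D_v ('D_u f) y| < e / 2 &
     `|'D_u ('D_v f) x - 'D_u ('D_v f) y| < e / 2]).
  exact: (filterS3 _ (fun y a b c => And3 a b c) df cvu cuv).
(* The summand 1 keeps [k] positive when [u = v = 0]; with [h = d / k / 2] the whole parallelogram
   lies in the ball of radius [d]. *)
pose k := `|u| + `|v| + 1.
have k0 : 0 < k by rewrite /k ltr_pwDr // addr_ge0.
pose h := d / k / 2.
have h0 : 0 < h by rewrite /h !divr_gt0.
have B s t : 0 <= s <= h -> 0 <= t <= h -> ball x d (x + s *: u + t *: v).
  move=> /andP[s0 sh] /andP[t0 th]; rewrite -ball_normE /ball_ /=.
  rewrite -addrA opprD addNKr normrN.
  apply: le_lt_trans (ler_normD _ _) _; rewrite !normrZ !ger0_norm //.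
  apply: (@le_lt_trans _ _ (h * k)).
    rewrite /k !mulrDr mulr1; apply: ler_wpDr; first exact: ltW.
    by rewrite lerD // ler_wpM2r.
  rewrite /h mulrAC divfK ?gt_eqF// ltr_pdivrMr // ltr_pMr // ltr1n //.
have [[c1 c2] /= /andP[c1h c2h] E1] := @second_difference R V f x u v h h0
  (fun s t sh th => let: And3 (And4 a _ b _) _ _ := H _ (B s t sh th) in conj a b).
have B' s t : 0 <= s <= h -> 0 <= t <= h -> ball x d (x + s *: v + t *: u).
  by move=> sh th; rewrite addrAC; apply: B.
have [[c3 c4] /= /andP[c3h c4h] E2] := @second_difference R V f x v u h h0
  (fun s t sh th => let: And3 (And4 _ a _ b) _ _ := H _ (B' s t sh th) in conj a b).
have E : 'D_v ('D_u f) (x + c1 *: u + c2 *: v) = 'D_u ('D_v f) (x + c3 *: v + c4 *: u).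
  have K (p q a b : R) : a = p * h * h -> b = q * h * h -> a = b -> p = q.
    have hn : h != 0 by rewrite gt_eqF.
    by move=> -> -> /(mulIf hn) /(mulIf hn).
  apply: (K _ _ _ _ E1 E2).
  by rewrite (addrAC x (h *: u)) subr_subACA.
have W a : 0 < a < h -> 0 <= a <= h by case/andP => ? ?; rewrite !ltW.
have [_ P1 _] := H _ (B c1 c2 (W _ c1h) (W _ c2h)).
have [_ _ P2] := H _ (B' c3 c4 (W _ c3h) (W _ c4h)).
by apply: ler_dist_halves P1 _; rewrite E.
Qed.

(** * Calculus of matrix-valued functions *)

Section MatrixCalculus.
Context (R : realType) (V : normedModType R).
Implicit Types (x v : V).

Lemma is_derive_mul (f g : V -> R) x v (df dg : R) :
  is_derive x v f df -> is_derive x v g dg ->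
  is_derive x v (fun y => f y * g y) (df * g x + f x * dg).
Proof.
move=> hf hg; rewrite addrC [df * _]mulrC; exact: (is_deriveM hf hg).
Qed.

Lemma is_derive_bigsum (I : Type) (r : seq I) (P : pred I) (f : I -> V -> R) x v
    (df : I -> R) : (forall i, P i -> is_derive x v (f i) (df i)) ->
  is_derive x v (fun y => \sum_(i <- r | P i) f i y) (\sum_(i <- r | P i) df i).
Proof.
move=> h; elim: r => [|i r IH].
  rewrite big_nil; under eq_fun do rewrite big_nil; exact: is_derive_cst.
rewrite big_cons; under eq_fun do rewrite big_cons.
by case: ifP => // /h hi; exact: is_deriveD.
Qed.

Lemma derivable_bigsum (I : Type) (r : seq I) (P : pred I) (f : I -> V -> R) x v :
  (forall i, P i -> derivable (f i) x v) ->
  derivable (fun y => \sum_(i <- r | P i) f i y) x v.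
Proof.
move=> h; have [] // := @is_derive_bigsum I r P f x v (fun i => 'D_v (f i) x).
by move=> i /h; exact: derivableP.
Qed.

Lemma derivable_mul (f g : V -> R) x v :
  derivable f x v -> derivable g x v -> derivable (fun y => f y * g y) x v.
Proof. by move=> df dg; exact: (derivableM df dg). Qed.

Lemma derivable_bigprod (I : Type) (r : seq I) (f : I -> V -> R) x v :
  (forall i, derivable (f i) x v) ->
  derivable (fun y => \prod_(i <- r) f i y) x v.
Proof.
move=> h; elim: r => [|i r IH].
  under eq_fun do rewrite big_nil; exact: derivable_cst.
by under eq_fun do rewrite big_cons; exact: derivable_mul.
Qed.

Lemma derivable_det n (F : V -> 'M[R]_n) x v :
  (forall a b, derivable (fun y => F y a b) x v) ->
  derivable (fun y => \det (F y)) x v.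
Proof.
move=> dF; apply: derivable_bigsum => s _; apply: derivable_mul.
  exact: derivable_cst.
exact: derivable_bigprod.
Qed.

(** Cramer's rule: an entry is a cofactor divided by the determinant. Invertibility is asked near
    [x] and not only at [x], since [invmx] returns a singular matrix unchanged. *)
Lemma derivable_invmx n (F : V -> 'M[R]_n) x v a b :
  (forall a b, derivable (fun y => F y a b) x v) ->
  (\forall y \near x, F y \in unitmx) ->
  derivable (fun y => invmx (F y) a b) x v.
Proof.
move=> dF uF.
apply: (@near_eq_derivable _ _ _ (fun y => (\det (F y))^-1 * cofactor (F y) b a)).
  by apply: filterS uF => y Fy; rewrite /invmx Fy !mxE.
apply: derivable_mul.
  apply: derivableV (derivable_det dF).
  by rewrite -unitfE; exact: (nbhs_singleton uF).
apply: derivable_mul; first exact: derivable_cst.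
apply: derivable_det => c d.
rewrite (_ : (fun y => _) = fun y => F y (lift b c) (lift a d)) //.
by apply/funext => y; rewrite !mxE.
Qed.

Definition derivable_mx m n (F : V -> 'M[R]_(m, n)) x v : Prop :=
  forall a b, derivable (fun y => F y a b) x v.

Definition derive_mx m n (v : V) (F : V -> 'M[R]_(m, n)) x : 'M[R]_(m, n) :=
  \matrix_(a, b) 'D_v (fun y => F y a b) x.

Lemma near_eq_derive_mx m n (F H : V -> 'M[R]_(m, n)) x v :
  (\forall y \near x, F y = H y) -> derive_mx v F x = derive_mx v H x.
Proof.
move=> FH; apply/matrixP => a b; rewrite !mxE; apply: near_eq_derive.
by apply: filterS FH => y ->.
Qed.

Lemma derivable_mulmx m n p (F : V -> 'M[R]_(m, n)) (H : V -> 'M[R]_(n, p)) x v :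
  derivable_mx F x v -> derivable_mx H x v ->
  derivable_mx (fun y => F y *m H y) x v.
Proof.
move=> dF dH a b; under eq_fun do rewrite mxE.
by apply: derivable_bigsum => k _; exact: derivable_mul.
Qed.

Lemma derive_mulmx m n p (F : V -> 'M[R]_(m, n)) (H : V -> 'M[R]_(n, p)) x v :
  derivable_mx F x v -> derivable_mx H x v ->
  derive_mx v (fun y => F y *m H y) x =
  derive_mx v F x *m H x + F x *m derive_mx v H x.
Proof.
move=> dF dH; apply/matrixP => a b; rewrite !mxE -big_split /=.
under eq_fun do rewrite mxE.
apply: (@derive_val _ _ _ _ _ _ _); apply: is_derive_bigsum => k _; rewrite !mxE.
by apply: is_derive_mul; exact: derivableP.
Qed.

Lemma derive_addmx m n (F H : V -> 'M[R]_(m, n)) x v :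
  derivable_mx F x v -> derivable_mx H x v ->
  derive_mx v (fun y => F y + H y) x = derive_mx v F x + derive_mx v H x.
Proof.
move=> dF dH; apply/matrixP => a b; rewrite !mxE.
under eq_fun do rewrite mxE; exact: deriveD.
Qed.

Lemma derivable_trmx m n (F : V -> 'M[R]_(m, n)) x v :
  derivable_mx F x v -> derivable_mx (fun y => (F y)^T) x v.
Proof. by move=> dF a b; under eq_fun do rewrite mxE; exact: dF. Qed.

Lemma derive_trmx m n (F : V -> 'M[R]_(m, n)) x v :
  derive_mx v (fun y => (F y)^T) x = (derive_mx v F x)^T.
Proof.
by apply/matrixP => a b; rewrite !mxE; under eq_fun do rewrite mxE.
Qed.

Lemma derive_cst_mx m n (A : 'M[R]_(m, n)) x v :
  derive_mx v (fun=> A) x = 0.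
Proof. by apply/matrixP => a b; rewrite !mxE derive_cst. Qed.

Lemma derive_mulmxl m n p (A : 'M[R]_(m, n)) (F : V -> 'M[R]_(n, p)) x v :
  derivable_mx F x v ->
  derive_mx v (fun y => A *m F y) x = A *m derive_mx v F x.
Proof.
move=> dF; rewrite derive_mulmx ?derive_cst_mx ?mul0mx ?add0r //.
Qed.

Lemma derive_mulmxr m n p (F : V -> 'M[R]_(m, n)) (A : 'M[R]_(n, p)) x v :
  derivable_mx F x v ->
  derive_mx v (fun y => F y *m A) x = derive_mx v F x *m A.
Proof.
move=> dF; rewrite derive_mulmx ?derive_cst_mx ?mulmx0 ?addr0 //.
Qed.

End MatrixCalculus.

(** * The Levi-Civita connection and its curvature *)

(* Locking keeps unification from unfolding directional derivatives into limits. *)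
HB.lock Definition pderiv (R : realType) (i : 'I_4) (f : 'rV[R]_4 -> R)
  (x : 'rV[R]_4) : R := partial i f x.

HB.lock Definition pderivable (R : realType) (i : 'I_4) (f : 'rV[R]_4 -> R)
  (x : 'rV[R]_4) : Prop := derivable f x (coordvec R i).

HB.lock Definition pderiv_mx (R : realType) m n (i : 'I_4)
  (F : 'rV[R]_4 -> 'M[R]_(m, n)) (x : 'rV[R]_4) : 'M[R]_(m, n) :=
  \matrix_(a, b) pderiv i (fun y => F y a b) x.

HB.lock Definition connection_mx (R : realType) (g : 'rV[R]_4 -> 'M[R]_4)
  (i : 'I_4) (y : 'rV[R]_4) : 'M[R]_4 := \matrix_(j, k) christoffel g i j k y.

(** The Christoffel symbols of the first kind, g(nabla_i d_j, d_l). No inverse metric occurs in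
    them, so linear relations among the first derivatives of [g] apply directly. *)
HB.lock Definition lowered_connection (R : realType) (g : 'rV[R]_4 -> 'M[R]_4)
  (i : 'I_4) (y : 'rV[R]_4) : 'M[R]_4 := \matrix_(j, l) (2^-1 *
    (pderiv_mx i g y j l + pderiv_mx j g y i l - pderiv_mx l g y i j)).

HB.lock Definition covariant (R : realType) (g : 'rV[R]_4 -> 'M[R]_4)
  (i : 'I_4) (V : 'rV[R]_4 -> 'rV[R]_4) (x : 'rV[R]_4) : 'rV[R]_4 := nabla g i V x.

(** Row [k] is R(d_i, d_j) d_k: the endomorphism acts on row vectors from the right, which reverses
    the products of connection matrices in [curvature_mxE]. *)
HB.lock Definition curvature_mx (R : realType) (g : 'rV[R]_4 -> 'M[R]_4)
  (i j : 'I_4) (x : 'rV[R]_4) : 'M[R]_4 := \matrix_(k, l) riemann g i j k x 0 l.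

Lemma trmx_entry (R : Type) m n (A : 'M[R]_(m, n)) i j : A^T i j = A j i.
Proof. by rewrite mxE. Qed.

Lemma mx_entryD (R : nmodType) m n (A B : 'M[R]_(m, n)) i j :
  (A + B) i j = A i j + B i j.
Proof. by rewrite mxE. Qed.

Lemma mx_entryB (R : zmodType) m n (A B : 'M[R]_(m, n)) i j :
  (A - B) i j = A i j - B i j.
Proof. by rewrite !mxE. Qed.

Section PartialMatrix.
Context (R : realType).
Implicit Types (x : 'rV[R]_4) (i : 'I_4).

Definition pderivable_mx m n i (F : 'rV[R]_4 -> 'M[R]_(m, n)) x : Prop :=
  forall a b, pderivable i (fun y => F y a b) x.

Lemma pderivE i (f : 'rV[R]_4 -> R) x : pderiv i f x = partial i f x.
Proof. by rewrite unlock. Qed.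

Lemma pderivableE i (f : 'rV[R]_4 -> R) x :
  pderivable i f x = derivable f x (coordvec R i).
Proof. by rewrite unlock. Qed.

Lemma pderivable_mxE m n i (F : 'rV[R]_4 -> 'M[R]_(m, n)) x :
  pderivable_mx i F x <-> derivable_mx F x (coordvec R i).
Proof. by split=> h a b; have := h a b; rewrite pderivableE. Qed.

Lemma pderiv_mx_derive m n i (F : 'rV[R]_4 -> 'M[R]_(m, n)) x :
  pderiv_mx i F x = derive_mx (coordvec R i) F x.
Proof. by rewrite unlock; apply/matrixP => a b; rewrite !mxE unlock. Qed.

Lemma pderiv_mxE m n i (F : 'rV[R]_4 -> 'M[R]_(m, n)) x a b :
  pderiv_mx i F x a b = pderiv i (fun y => F y a b) x.
Proof. by rewrite unlock mxE. Qed.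

Lemma near_eq_pderiv i (f h : 'rV[R]_4 -> R) x :
  (\forall y \near x, f y = h y) -> pderiv i f x = pderiv i h x.
Proof. by rewrite !pderivE; exact: near_eq_derive. Qed.

Lemma pderiv_cst i (c : R) x : pderiv i (fun=> c) x = 0.
Proof. by rewrite !pderivE; exact: derive_cst. Qed.

Lemma near_eq_pderiv_mx m n i (F H : 'rV[R]_4 -> 'M[R]_(m, n)) x :
  (\forall y \near x, F y = H y) -> pderiv_mx i F x = pderiv_mx i H x.
Proof. by rewrite ?pderivable_mxE !pderiv_mx_derive; exact: near_eq_derive_mx. Qed.

Lemma pderivable_mulmx m n p i (F : 'rV[R]_4 -> 'M[R]_(m, n))
    (H : 'rV[R]_4 -> 'M[R]_(n, p)) x :
  pderivable_mx i F x -> pderivable_mx i H x ->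
  pderivable_mx i (fun y => F y *m H y) x.
Proof. by rewrite !pderivable_mxE; exact: derivable_mulmx. Qed.

Lemma pderiv_mulmx m n p i (F : 'rV[R]_4 -> 'M[R]_(m, n))
    (H : 'rV[R]_4 -> 'M[R]_(n, p)) x :
  pderivable_mx i F x -> pderivable_mx i H x ->
  pderiv_mx i (fun y => F y *m H y) x =
  pderiv_mx i F x *m H x + F x *m pderiv_mx i H x.
Proof. by rewrite ?pderivable_mxE !pderiv_mx_derive; exact: derive_mulmx. Qed.

Lemma pderiv_addmx m n i (F H : 'rV[R]_4 -> 'M[R]_(m, n)) x :
  pderivable_mx i F x -> pderivable_mx i H x ->
  pderiv_mx i (fun y => F y + H y) x = pderiv_mx i F x + pderiv_mx i H x.
Proof. by rewrite ?pderivable_mxE !pderiv_mx_derive; exact: derive_addmx. Qed.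

Lemma pderivable_trmx m n i (F : 'rV[R]_4 -> 'M[R]_(m, n)) x :
  pderivable_mx i F x -> pderivable_mx i (fun y => (F y)^T) x.
Proof. by rewrite !pderivable_mxE; exact: derivable_trmx. Qed.

Lemma pderiv_trmx m n i (F : 'rV[R]_4 -> 'M[R]_(m, n)) x :
  pderiv_mx i (fun y => (F y)^T) x = (pderiv_mx i F x)^T.
Proof. by rewrite ?pderivable_mxE !pderiv_mx_derive; exact: derive_trmx. Qed.

Lemma pderiv_mulmxl m n p i (A : 'M[R]_(m, n)) (F : 'rV[R]_4 -> 'M[R]_(n, p)) x :
  pderivable_mx i F x ->
  pderiv_mx i (fun y => A *m F y) x = A *m pderiv_mx i F x.
Proof. by rewrite ?pderivable_mxE !pderiv_mx_derive; exact: derive_mulmxl. Qed.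

Lemma pderiv_mulmxr m n p i (F : 'rV[R]_4 -> 'M[R]_(m, n)) (A : 'M[R]_(n, p)) x :
  pderivable_mx i F x ->
  pderiv_mx i (fun y => F y *m A) x = pderiv_mx i F x *m A.
Proof. by rewrite ?pderivable_mxE !pderiv_mx_derive; exact: derive_mulmxr. Qed.

End PartialMatrix.

Section Entries.
Context (R : realType) (g : 'rV[R]_4 -> 'M[R]_4).
Implicit Types (x y : 'rV[R]_4) (i j k l : 'I_4).

Lemma connection_mxE i y j k : connection_mx g i y j k =
  2^-1 * \sum_(l < 4) invmx (g y) k l *
    (pderiv_mx i g y j l + pderiv_mx j g y i l - pderiv_mx l g y i j).
Proof.
rewrite unlock mxE; congr (_ * _); apply: eq_bigr => l _.
by rewrite !pderiv_mxE !pderivE.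
Qed.

Lemma lowered_connectionE i y j l : lowered_connection g i y j l =
  2^-1 * (pderiv_mx i g y j l + pderiv_mx j g y i l - pderiv_mx l g y i j).
Proof. by rewrite unlock mxE. Qed.

Lemma covariantE i V x l : covariant g i V x 0 l =
  pderiv i (fun y => V y 0 l) x + \sum_(k < 4) V x 0 k * connection_mx g i x k l.
Proof.
rewrite unlock mxE pderivE; congr (_ + _); apply: eq_bigr => k _.
by rewrite unlock mxE.
Qed.

Lemma curvature_mx_covariant i j x k l : curvature_mx g i j x k l =
  covariant g i (covariant g j (fun=> coordvec R k)) x 0 l
  - covariant g j (covariant g i (fun=> coordvec R k)) x 0 l.
Proof.
have E a V y : nabla g a V y = covariant g a V y by rewrite covariant.unlock.
have E' a : nabla g a (fun=> coordvec R k) = covariant g a (fun=> coordvec R k).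
  by apply/funext => y; exact: E.
by rewrite curvature_mx.unlock mxE /riemann !E' !E mx_entryB.
Qed.

End Entries.

(** [Gi] and [Gj] stand for connection matrices, [Di] for the [j]-th derivative of [Gi], [Dj] for
    the [i]-th derivative of [Gj]. The right-hand side is the difference of the two mixed
    derivatives of the metric [G], each expanded by metric compatibility. *)
Lemma skew_identity (R : comPzRingType) n (G Gi Gj Di Dj : 'M[R]_n) :
  - ((Dj - Di + (Gj *m Gi - Gi *m Gj)) *m G
     + G *m (Dj - Di + (Gj *m Gi - Gi *m Gj))^T) =
  Di *m G + Gi *m (Gj *m G + G *m Gj^T)
  + ((Gj *m G + G *m Gj^T) *m Gi^T + G *m Di^T)
  - (Dj *m G + Gj *m (Gi *m G + G *m Gi^T)
  + ((Gi *m G + G *m Gi^T) *m Gj^T + G *m Dj^T)).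
Proof.
have trB (A B : 'M[R]_n) : (A - B)^T = A^T - B^T by exact: linearB.
have trD (A B : 'M[R]_n) : (A + B)^T = A^T + B^T by exact: linearD.
rewrite trD !trB !trmx_mul.
rewrite !(mulmxDl, mulmxDr, mulmxBl, mulmxBr, mulNmx, mulmxN) !mulmxA.
move: (Di *m G) (Dj *m G) (G *m Di^T) (G *m Dj^T) => a b c d.
move: (Gi *m Gj *m G) (Gj *m Gi *m G) (Gi *m G *m Gj^T) => e f h.
move: (Gj *m G *m Gi^T) (G *m Gi^T *m Gj^T) (G *m Gj^T *m Gi^T) => k l m.
by apply/matrixP => p q; rewrite !mxE; ring.
Qed.

Section LocalGeometry.
Context (R : realType) (g : 'rV[R]_4 -> 'M[R]_4) (U : set 'rV[R]_4).
Context (Uopen : open U)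
  (gsmooth : forall a b, smooth_on U (fun y => g y a b))
  (gsym : forall y, U y -> (g y)^T = g y)
  (gunit : forall y, U y -> g y \in unitmx).

Let D i y := pderiv_mx i g y.
Let L := lowered_connection g.
Let Gam := connection_mx g.

Lemma near_open (P : 'rV[R]_4 -> Prop) x : U x -> (forall y, U y -> P y) ->
  \forall y \near x, P y.
Proof.
by move=> Ux UP; apply: filterS UP _; apply: open_nbhs_nbhs; split.
Qed.

Lemma derive_metric_sym i x : U x -> (D i x)^T = D i x.
Proof.
move=> Ux; rewrite -pderiv_trmx; apply: near_eq_pderiv_mx.
exact: near_open gsym.
Qed.

Lemma derive_metricC i x a b : U x -> D i x a b = D i x b a.
Proof. by move=> Ux; rewrite -{1}(derive_metric_sym i Ux) mxE. Qed.

Lemma connection_lower i y : Gam i y = L i y *m (invmx (g y))^T.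
Proof.
apply/matrixP => j k; rewrite connection_mxE mxE mulr_sumr.
apply: eq_bigr => l _; rewrite lowered_connectionE trmx_entry.
by rewrite mulrCA mulrC.
Qed.

Lemma connection_metric i y : U y -> Gam i y *m g y = L i y.
Proof.
move=> Uy; rewrite connection_lower trmx_inv gsym // mulmxKV //.
exact: gunit.
Qed.

(** In [L i y] the last two terms are antisymmetric in the two matrix indices, so adding the
    transpose leaves the derivative of [g]. *)
Lemma metric_compatible i y : U y ->
  D i y = Gam i y *m g y + g y *m (Gam i y)^T.
Proof.
move=> Uy.
have -> : g y *m (Gam i y)^T = (L i y)^T.
  by rewrite -connection_metric // trmx_mul gsym.
rewrite connection_metric //; apply/matrixP => a b.
rewrite mx_entryD trmx_entry !lowered_connectionE (derive_metricC i b a Uy).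
move: (pderiv_mx _ _ _ _ _) (pderiv_mx _ _ _ _ _) (pderiv_mx _ _ _ _ _) => p q r.
by field.
Qed.

Lemma connection_sym i j k y : U y -> Gam i y j k = Gam j y i k.
Proof.
move=> Uy; rewrite !connection_mxE; congr (_ * _); apply: eq_bigr => l _.
by rewrite (derive_metricC l i j Uy) [in LHS](addrC (pderiv_mx i g y j l)).
Qed.

Lemma metric_Ck a b k : Ck k U (fun y => g y a b).
Proof. exact: gsmooth. Qed.

Lemma derivable_partial_metric i j y a b : U y ->
  derivable (partial i (fun y => g y a b)) y (coordvec R j).
Proof.
by move=> Uy; have [_ d] := metric_Ck a b 2 i; have [e _] := d j; exact: e.
Qed.

Lemma partial_metric_comm i j x a b : U x ->
  partial i (partial j (fun y => g y a b)) x =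
  partial j (partial i (fun y => g y a b)) x.
Proof.
move=> Ux; apply: derive_comm.
- apply: near_open => // y Uy; split.
  + by have [d _] := metric_Ck a b 1 j; exact: d.
  + by have [d _] := metric_Ck a b 1 i; exact: d.
  + exact: derivable_partial_metric.
  + exact: derivable_partial_metric.
- by have [_ d] := metric_Ck a b 2 j; have [_ e] := d i; exact: e.
- by have [_ d] := metric_Ck a b 2 i; have [_ e] := d j; exact: e.
Qed.

Lemma derivable_connection i j x : U x ->
  pderivable_mx j (Gam i) x.
Proof.
move=> Ux a b; rewrite pderivableE.
under eq_fun do rewrite connection_mxE.
apply: derivable_mul; first exact: derivable_cst.
apply: derivable_bigsum => l _; apply: derivable_mul.
  apply: derivable_invmx; last exact: near_open gunit.
  by move=> c d; have [e _] := metric_Ck c d 1 j; exact: e.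
under eq_fun do rewrite !pderiv_mxE !pderivE.
apply: derivableB; last exact: derivable_partial_metric.
by apply: derivableD; exact: derivable_partial_metric.
Qed.

Lemma covariant_coordvec j k y :
  covariant g j (fun=> coordvec R k) y = row k (Gam j y).
Proof.
apply/rowP => l; rewrite covariantE [RHS]mxE (bigD1 k) //= big1 ?addr0; last first.
  by move=> m /negPf mk; rewrite mxE eqxx mk mul0r.
by rewrite pderiv_cst add0r mxE !eqxx mul1r.
Qed.

Lemma curvature_mxE i j x : curvature_mx g i j x =
  pderiv_mx i (Gam j) x - pderiv_mx j (Gam i) x
  + (Gam j x *m Gam i x - Gam i x *m Gam j x).
Proof.
have H a b k l : covariant g a (covariant g b (fun=> coordvec R k)) x 0 l =
    (pderiv_mx a (Gam b) x + Gam b x *m Gam a x) k l.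
  rewrite covariantE mxE pderiv_mxE [X in _ = _ + X]mxE; congr (_ + _).
    by congr (pderiv _ _ _); apply/funext => y; rewrite covariant_coordvec mxE.
  by apply: eq_bigr => m _; rewrite covariant_coordvec mxE.
apply/matrixP => k l; rewrite curvature_mx_covariant !H.
move: (pderiv_mx _ _ _) (pderiv_mx _ _ _) (_ *m _) (_ *m _) => A B C E.
by rewrite !mxE; ring.
Qed.

Lemma curvature_mxC i j x : curvature_mx g j i x = - curvature_mx g i j x.
Proof. by rewrite !curvature_mxE opprD !opprB. Qed.

Lemma near_eq_covariant i (V W : 'rV[R]_4 -> 'rV[R]_4) x : U x ->
  (forall y, U y -> V y = W y) -> covariant g i V x = covariant g i W x.
Proof.
move=> Ux VW; apply/rowP => l; rewrite !covariantE VW //; congr (_ + _).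
by apply: near_eq_pderiv; apply: near_open => // y /VW ->.
Qed.

(** By torsion-freeness, nabla_i d_k = nabla_k d_i, the six second covariant derivatives cancel in
    pairs. *)
Lemma curvature_mx_bianchi i j k l x : U x ->
  curvature_mx g i j x k l + curvature_mx g j k x i l
  + curvature_mx g k i x j l = 0.
Proof.
move=> Ux.
have C a b c : covariant g c (covariant g a (fun=> coordvec R b)) x =
    covariant g c (covariant g b (fun=> coordvec R a)) x.
  apply: near_eq_covariant => // y Uy; rewrite !covariant_coordvec.
  by apply/rowP => m; rewrite 2!mxE; exact: connection_sym.
rewrite !curvature_mx_covariant (C i k) (C j i) (C k j).
move: (covariant _ _ _ _ _ _) (covariant _ _ _ _ _ _) (covariant _ _ _ _ _ _).
by move=> a b c; ring.
Qed.

(** Equality of the mixed derivatives of [g], with both sides expanded by metric compatibility, is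
    this identity up to sign ([skew_identity]). *)
Lemma curvature_mx_skew i j x : U x ->
  curvature_mx g i j x *m g x + g x *m (curvature_mx g i j x)^T = 0.
Proof.
move=> Ux.
have H a b : pderiv_mx b (D a) x =
    pderiv_mx b (Gam a) x *m g x + Gam a x *m D b x
    + (D b x *m (Gam a x)^T + g x *m (pderiv_mx b (Gam a) x)^T).
  have dg : pderivable_mx b g x.
    by move=> c d; rewrite pderivableE; have [e _] := metric_Ck c d 1 b; exact: e.
  have dG : pderivable_mx b (Gam a) x by exact: derivable_connection.
  rewrite (@near_eq_pderiv_mx _ _ _ b _ (fun y => Gam a y *m g y + g y *m (Gam a y)^T)).
    rewrite pderiv_addmx; first last.
    - exact: pderivable_mulmx dg (pderivable_trmx dG).
    - exact: pderivable_mulmx.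
    by rewrite pderiv_mulmx // pderiv_mulmx ?pderiv_trmx //; exact: pderivable_trmx.
  by apply: near_open => // y; exact: metric_compatible.
have E : pderiv_mx j (D i) x = pderiv_mx i (D j) x.
  apply/matrixP => a b; rewrite !pderiv_mxE !pderivE.
  transitivity (partial j (partial i (fun y => g y a b)) x).
    by congr (partial _ _ _); apply/funext => y; rewrite pderiv_mxE pderivE.
  rewrite partial_metric_comm //.
  by congr (partial _ _ _); apply/funext => y; rewrite pderiv_mxE pderivE.
move: E; rewrite !H !metric_compatible // curvature_mxE => /eqP.
rewrite -subr_eq0 => /eqP E; apply/eqP; rewrite -oppr_eq0 -E; apply/eqP.
exact: skew_identity.
Qed.

End LocalGeometry.

(** * The complex structure is parallel *)

Notation o0 := (@Ordinal 4 0 isT).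
Notation o1 := (@Ordinal 4 1 isT).
Notation o2 := (@Ordinal 4 2 isT).
Notation o3 := (@Ordinal 4 3 isT).

Lemma ord4_ind (P : 'I_4 -> Prop) : P o0 -> P o1 -> P o2 -> P o3 -> forall a, P a.
Proof.
by move=> p0 p1 p2 p3 [[|[|[|[|]]]] h] //; rewrite (bool_irrelevance h isT).
Qed.

Lemma big_ord4 (R : nmodType) (F : 'I_4 -> R) :
  \sum_(a < 4) F a = F o0 + F o1 + F o2 + F o3.
Proof.
rewrite !big_ord_recl big_ord0 addr0 !addrA.
by congr (F _ + F _ + F _ + F _); exact: val_inj.
Qed.

(* [J0] is a signed permutation matrix: it maps [d_a] to
   [J_sign a] times [d_(J_index a)]. *)
Definition J_index (a : 'I_4) : 'I_4 := tnth [tuple o1; o0; o3; o2] a.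

Definition J_sign (R : pzRingType) (a : 'I_4) : R := (-1) ^+ odd a.

Lemma J_indexK : involutive J_index.
Proof. by elim/ord4_ind. Qed.

Lemma J_signN (R : pzRingType) a : J_sign R (J_index a) = - J_sign R a.
Proof. by elim/ord4_ind: a; rewrite /J_sign /= ?expr0 ?expr1 ?opprK. Qed.

Lemma J0_entry (R : realType) a b :
  J0 R a b = J_sign R a * (b == J_index a)%:R.
Proof.
elim/ord4_ind: a; elim/ord4_ind: b;
  by rewrite mxE /J_sign /= ?expr0 ?expr1 ?mul1r ?mulN1r ?oppr0.
Qed.

Lemma mul_J0mx (R : realType) n (A : 'M[R]_(4, n)) a b :
  (J0 R *m A) a b = J_sign R a * A (J_index a) b.
Proof.
rewrite mxE (bigD1 (J_index a)) //= big1 ?addr0 => [|k /negPf kj].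
  by rewrite J0_entry eqxx mulr1.
by rewrite J0_entry kj mulr0 mul0r.
Qed.

Lemma mulmx_J0 (R : realType) n (A : 'M[R]_(n, 4)) a b :
  (A *m J0 R) a b = - J_sign R b * A a (J_index b).
Proof.
rewrite mxE (bigD1 (J_index b)) //= big1 ?addr0 => [|k kj].
  by rewrite J0_entry J_indexK eqxx mulr1 J_signN mulrC.
rewrite J0_entry (_ : b == J_index k = false) ?mulr0 //.
by apply: contraNF kj => /eqP ->; rewrite J_indexK.
Qed.

Lemma J0_sqr (R : realType) : J0 R *m J0 R = - 1%:M.
Proof.
apply/matrixP => a b; rewrite mul_J0mx J0_entry J_signN J_indexK !mxE eq_sym.
by rewrite mulrA mulrN /J_sign -expr2 sqrr_sign mulN1r.
Qed.

Lemma J0_tr (R : realType) : (J0 R)^T = - J0 R.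
Proof.
apply/matrixP => a b; rewrite trmx_entry [RHS]mxE !J0_entry.
elim/ord4_ind: a; elim/ord4_ind: b;
  by rewrite /J_sign /= ?expr0 ?expr1 ?mul1r ?mulN1r ?oppr0 ?opprK.
Qed.

Lemma hermitian_commute (R : realType) (A : 'M[R]_4) :
  J0 R *m A *m (J0 R)^T = A -> J0 R *m A = A *m J0 R.
Proof.
move=> h; rewrite -[in RHS]h -mulmxA J0_tr mulNmx J0_sqr opprK mulmx1.
by [].
Qed.

(* With [D a b c] for [d_a g_bc] and [s k * D i (j k) l] for
   [d_i omega_kl], the left-hand side is
   [domega(i, k, l) - domega(i, J k, J l)], up to the hermitian symmetry of [D]. *)
Lemma kahler_lowered (R : realFieldType) (T : Type) (D : T -> T -> T -> R)
    (j : T -> T) (s : T -> R) :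
  involutive j -> (forall a, s (j a) = - s a) ->
  (forall a, s a = 1 \/ s a = -1) ->
  (forall i a b, D i a b = D i b a) ->
  (forall i a b, s a * D i (j a) b = - s b * D i a (j b)) ->
  (forall a b c, s b * D a (j b) c + s c * D b (j c) a + s a * D c (j a) b = 0) ->
  forall i k l, s k * (D i (j k) l + D (j k) i l - D l i (j k)) =
    - s l * (D i k (j l) + D k i (j l) - D (j l) i k).
Proof.
move=> jK sN s1 Dsym Dinv dw i k l.
have := dw i k l; have := dw i (j k) (j l).
have := Dinv (j l) i (j k); have := Dinv l i k; have := Dinv i k l.
rewrite !jK !sN (Dsym k (j l) i) (Dsym (j k) l i).
by case: (s1 i) (s1 k) (s1 l) => -> [] -> [] ->; lra.
Qed.

Section KahlerGeometry.
Context (R : realType) (g : 'rV[R]_4 -> 'M[R]_4) (U : set 'rV[R]_4).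
Context (Uopen : open U)
  (gsmooth : forall a b, smooth_on U (fun y => g y a b))
  (gsym : forall y, U y -> (g y)^T = g y)
  (gunit : forall y, U y -> g y \in unitmx)
  (gherm : forall y, U y -> J0 R *m g y *m (J0 R)^T = g y)
  (gkahler : forall y a b c, U y ->
     let omega a b := fun x => (J0 R *m g x) a b in
     partial a (omega b c) y + partial b (omega c a) y
     + partial c (omega a b) y = 0).

Let J := J0 R.

Lemma pderivable_metric i y : U y -> pderivable_mx i g y.
Proof.
move=> Uy a b; rewrite pderivableE.
by have [e _] := gsmooth a b 1 i; exact: e.
Qed.

Lemma derive_metric_hermitian i y : U y ->
  J *m pderiv_mx i g y = pderiv_mx i g y *m J.
Proof.
move=> Uy; rewrite -pderiv_mulmxl; last exact: pderivable_metric.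
rewrite -pderiv_mulmxr; last exact: pderivable_metric.
apply: near_eq_pderiv_mx; apply: (near_open Uopen Uy) => z /gherm.
exact: hermitian_commute.
Qed.

Lemma kahler_form_pderiv a b c y : U y ->
  partial a (fun x => (J0 R *m g x) b c) y =
  J_sign R b * pderiv_mx a g y (J_index b) c.
Proof.
move=> Uy; rewrite -mul_J0mx -pderiv_mulmxl; last exact: pderivable_metric.
by rewrite pderiv_mxE pderivE.
Qed.

(** This is nabla J = 0 with an index lowered: as [J0] is constant in the chart, J is parallel
    exactly when the connection matrices commute with it. Closedness of the Kähler form enters
    here. *)
Lemma lowered_connection_J0 i y : U y ->
  J *m lowered_connection g i y = lowered_connection g i y *m J.
Proof.
move=> Uy; apply/matrixP => k l; rewrite mul_J0mx mulmx_J0 !lowered_connectionE.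
rewrite mulrCA [RHS]mulrCA; congr (_ * _).
apply: (@kahler_lowered _ _ (fun i => pderiv_mx i g y) J_index (J_sign R)).
- exact: J_indexK.
- exact: J_signN.
- by elim/ord4_ind; rewrite /J_sign /= ?expr0 ?expr1; [left|right|left|right].
- by move=> m a b; exact: (derive_metricC Uopen gsym).
- by move=> m a b; rewrite -mul_J0mx derive_metric_hermitian // mulmx_J0.
- by move=> a b c; rewrite -!kahler_form_pderiv //; exact: gkahler.
Qed.

Lemma connection_J0 i y : U y ->
  J *m connection_mx g i y = connection_mx g i y *m J.
Proof.
move=> Uy; have gJ : J *m g y = g y *m J by exact: hermitian_commute (gherm Uy).
have giJ : J *m invmx (g y) = invmx (g y) *m J.
  rewrite -[RHS](mulmxK (gunit Uy)) -(mulmxA (invmx _) J) gJ mulKmx //.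
  exact: gunit.
rewrite connection_lower trmx_inv gsym // mulmxA lowered_connection_J0 //.
by rewrite -!mulmxA giJ.
Qed.

Lemma curvature_mx_J0 i j x : U x ->
  J *m curvature_mx g i j x = curvature_mx g i j x *m J.
Proof.
move=> Ux.
have H a b : J *m pderiv_mx b (connection_mx g a) x =
    pderiv_mx b (connection_mx g a) x *m J.
  have dG : pderivable_mx b (connection_mx g a) x.
    by apply: (derivable_connection Uopen gsmooth gunit).
  rewrite -pderiv_mulmxl // -pderiv_mulmxr //.
  by apply: near_eq_pderiv_mx; apply: (near_open Uopen Ux) => y; exact: connection_J0.
have K a b : J *m (connection_mx g a x *m connection_mx g b x) =
    connection_mx g a x *m connection_mx g b x *m J.
  by rewrite mulmxA connection_J0 // -mulmxA connection_J0 // mulmxA.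
rewrite !curvature_mxE !(mulmxDr, mulmxDl, mulmxN, mulNmx).
by rewrite !H !K.
Qed.

End KahlerGeometry.

(** * The curvature as a multilinear function of tangent vectors *)

Lemma curvE (R : realType) (g : 'rV[R]_4 -> 'M[R]_4) x i j k l :
  curv g x i j k l = (curvature_mx g i j x *m g x) l k.
Proof.
have ck m : (coordvec R k)^T m 0 = (m == k)%:R by rewrite trmx_entry mxE eqxx.
rewrite /curv /inner mxE (bigD1 k) //= big1 ?addr0 => [|m /negPf mk]; last first.
  by rewrite ck mk mulr0.
rewrite ck eqxx mulr1 mxE [RHS]mxE; apply: eq_bigr => m _.
by rewrite curvature_mx.unlock; congr (_ * _); rewrite [RHS]mxE.
Qed.

Lemma curvature_matrix (R : realType) (g : 'rV[R]_4 -> 'M[R]_4) x X Y Z W :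
  curvature g x X Y Z W = \sum_(i < 4) \sum_(j < 4) X 0 i * Y 0 j *
    (W *m (curvature_mx g i j x *m g x) *m Z^T) 0 0.
Proof.
apply: eq_bigr => i _; apply: eq_bigr => j _.
rewrite mxE mulr_sumr; apply: eq_bigr => k _.
rewrite mxE mulr_suml mulr_sumr; apply: eq_bigr => l _.
by rewrite curvE trmx_entry; move: (_ *m _) => A; ring.
Qed.

Definition linear_functional (R : pzRingType) (f : 'rV[R]_4 -> R) : Prop :=
  forall c X Y, f (c *: X + Y) = c * f X + f Y.

Lemma linear_functional_frame (R : comNzRingType) (f : 'rV[R]_4 -> R) :
  linear_functional f -> forall (y : 'rV[R]_4) (P : 'M[R]_4),
  f (y *m P) = \sum_(a < 4) y 0 a * f (row a P).
Proof.
move=> lf y P; rewrite mulmx_sum_row.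
have f0 : f 0 = 0.
  by have := lf (-1) 0 0; rewrite scaler0 addr0 mulN1r addNr.
by elim/big_rec2: _ => // a c X _ <-; rewrite lf.
Qed.

(** Moves a cyclic permutation of [X], [Y], [W] onto the indices, so that the three terms of the
    Bianchi sum share the weights [X i * Y j * Z k * W l] and add up index by index. *)
Lemma quadruple_sum_rot (R : comPzRingType) (X Y Z W : 'I_4 -> R)
    (t : 'I_4 -> 'I_4 -> 'I_4 -> 'I_4 -> R) :
  \sum_i \sum_j \sum_k \sum_l Y i * W j * Z k * X l * t i j k l =
  \sum_i \sum_j \sum_k \sum_l X i * Y j * Z k * W l * t j l k i.
Proof.
under eq_bigr => i _ do under eq_bigr => j _ do rewrite exchange_big.
under eq_bigr => i _ do rewrite exchange_big.
rewrite exchange_big; apply: eq_bigr => l _; apply: eq_bigr => i _.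
rewrite exchange_big; apply: eq_bigr => k _; apply: eq_bigr => j _.
by congr (_ * _); ring.
Qed.

Lemma sum3_eq0 (V : nmodType) n (F G H : 'I_n -> V) :
  (forall i, F i + G i + H i = 0) ->
  \sum_i F i + \sum_i G i + \sum_i H i = 0.
Proof. by move=> h; rewrite -!big_split big1 //= => i _; exact: h. Qed.

(* [A X Y Z W] is [g(R(X, Y) W, Z)], whence the index order in the Bianchi
   identity. *)
Record kahler_curvature (R : realType)
    (A : 'rV[R]_4 -> 'rV[R]_4 -> 'rV[R]_4 -> 'rV[R]_4 -> R) : Prop := {
  kc_linear1 : forall Y Z W, linear_functional (fun X => A X Y Z W);
  kc_linear2 : forall X Z W, linear_functional (fun Y => A X Y Z W);
  kc_linear3 : forall X Y W, linear_functional (fun Z => A X Y Z W);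
  kc_linear4 : forall X Y Z, linear_functional (A X Y Z);
  kc_skew12 : forall X Y Z W, A Y X Z W = - A X Y Z W;
  kc_skew34 : forall X Y Z W, A X Y W Z = - A X Y Z W;
  kc_bianchi : forall X Y Z W, A X Y Z W + A Y W Z X + A W X Z Y = 0;
  kc_J : forall X Y Z W, A X Y (Z *m J0 R) (W *m J0 R) = A X Y Z W
}.

Section CurvatureTensor.
Context (R : realType) (g : 'rV[R]_4 -> 'M[R]_4) (U : set 'rV[R]_4).
Context (Uopen : open U)
  (gsmooth : forall a b, smooth_on U (fun y => g y a b))
  (gsym : forall y, U y -> (g y)^T = g y)
  (gunit : forall y, U y -> g y \in unitmx)
  (gherm : forall y, U y -> J0 R *m g y *m (J0 R)^T = g y)
  (gkahler : forall y a b c, U y ->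
     let omega a b := fun x => (J0 R *m g x) a b in
     partial a (omega b c) y + partial b (omega c a) y
     + partial c (omega a b) y = 0).

Lemma curv_bianchi x i j k l : U x ->
  curv g x i j l k + curv g x j k l i + curv g x k i l j = 0.
Proof.
move=> Ux; rewrite !curvE !mxE -!big_split /= big1 // => m _.
rewrite -!mulrDl; apply/eqP; rewrite mulf_eq0; apply/orP; left; apply/eqP.
exact: (curvature_mx_bianchi Uopen gsym).
Qed.

Lemma curvature_kahler x : U x -> kahler_curvature (curvature g x).
Proof.
move=> Ux; split.
- move=> Y Z W c X X'; rewrite /curvature; do 4![
    rewrite mulr_sumr -big_split; apply: eq_bigr => ? _ /=].
  by rewrite !mxE; move: (curv _ _ _ _ _ _) => t; ring.
- move=> Y Z W c X X'; rewrite /curvature; do 4![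
    rewrite mulr_sumr -big_split; apply: eq_bigr => ? _ /=].
  by rewrite !mxE; move: (curv _ _ _ _ _ _) => t; ring.
- move=> Y Z W c X X'; rewrite /curvature; do 4![
    rewrite mulr_sumr -big_split; apply: eq_bigr => ? _ /=].
  by rewrite !mxE; move: (curv _ _ _ _ _ _) => t; ring.
- move=> Y Z W c X X'; rewrite /curvature; do 4![
    rewrite mulr_sumr -big_split; apply: eq_bigr => ? _ /=].
  by rewrite !mxE; move: (curv _ _ _ _ _ _) => t; ring.
- move=> X Y Z W; rewrite !curvature_matrix exchange_big -sumrN.
  apply: eq_bigr => i _; rewrite -sumrN; apply: eq_bigr => j _.
  rewrite curvature_mxC !(mulNmx, mulmxN) [X in _ * X]mxE mulrN.
  by rewrite [X 0 i * _]mulrC.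
- move=> X Y Z W; rewrite !curvature_matrix -sumrN.
  apply: eq_bigr => i _; rewrite -sumrN; apply: eq_bigr => j _.
  rewrite -mulrN; congr (_ * _).
  have /eqP := curvature_mx_skew Uopen gsmooth gsym gunit i j Ux.
  rewrite -[X in _ + X *m _]gsym // -trmx_mul addr_eq0 => /eqP E.
  rewrite [in LHS]E mulmxN mulNmx mxE; congr (- _).
  by rewrite -[LHS]trmx_entry !trmx_mul !trmxK mulmxA.
- move=> X Y Z W.
  have rot := quadruple_sum_rot (X 0) (Y 0) (Z 0) (W 0).
  have E1 : curvature g x Y W Z X = _ := rot (curv g x).
  have E2 : curvature g x W X Z Y = _ :=
    etrans (quadruple_sum_rot (Y 0) (W 0) (Z 0) (X 0) (curv g x))
      (rot (fun i j k l => curv g x j l k i)).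
  rewrite E1 E2; apply: sum3_eq0 => i; apply: sum3_eq0 => j.
  apply: sum3_eq0 => k; apply: sum3_eq0 => l.
  have := curv_bianchi i j l k Ux.
  move: (curv _ _ i _ _ _) (curv _ _ j _ _ _) (curv _ _ l _ _ _) => a b c abc.
  by rewrite -!mulrDr abc mulr0.
- move=> X Y Z W; rewrite !curvature_matrix.
  apply: eq_bigr => i _; apply: eq_bigr => j _; congr (_ * _).
  rewrite trmx_mul !mulmxA -(mulmxA W) (curvature_mx_J0 Uopen) //.
  rewrite !mulmxA -(mulmxA _ (J0 R) (g x)) (hermitian_commute (gherm Ux)).
  by rewrite !mulmxA -(mulmxA _ (J0 R) _^T) J0_tr mulmxN J0_sqr opprK mulmx1.
Qed.

End CurvatureTensor.

(** * The Hodge star in a unitary frame *)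

(* Expansion along complementary 2x2 minors of the first and last two rows. *)
Definition det4 (R : comPzRingType) (M : 'I_4 -> 'I_4 -> R) : R :=
  let m2 i j k l := M i k * M j l - M i l * M j k in
  m2 o0 o1 o0 o1 * m2 o2 o3 o2 o3 - m2 o0 o1 o0 o2 * m2 o2 o3 o1 o3
  + m2 o0 o1 o0 o3 * m2 o2 o3 o1 o2 + m2 o0 o1 o1 o2 * m2 o2 o3 o0 o3
  - m2 o0 o1 o1 o3 * m2 o2 o3 o0 o2 + m2 o0 o1 o2 o3 * m2 o2 o3 o0 o1.

Lemma det_mx44 (R : comNzRingType) (M : 'M[R]_4) : \det M = det4 M.
Proof.
(* With entries indexed by natural numbers, the lifted ordinals of the nested cofactor expansions
   reduce to numerals and [ring] recognises equal entries. *)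
pose F (a b : nat) := M (inord a) (inord b).
have -> : M = \matrix_(i, j) F i j.
  by apply/matrixP => i j; rewrite mxE /F !inord_val.
have E (i j : 'I_4) : (\matrix_(i, j) F i j) i j = F i j by rewrite mxE.
rewrite /det4 !E /=.
do 3![rewrite !(expand_det_row _ ord0) !big_ord_recl !big_ord0 /cofactor /=].
rewrite ?det_mx11 !mxE /= /bump /=.
move: F {E} => F; rewrite !addr0 ?expr0 ?expr1 ?exprS.
ring.
Qed.

(** Integer-valued and built on the explicit [det4], so that [vm_compute] finds each value. *)
Definition epsilon (i j k l : 'I_4) : int :=
  det4 (fun a b => (tnth [tuple i; j; k; l] a == b)%:Z).

Lemma levi_civitaE (R : realType) i j k l :
  levi_civita R i j k l = (epsilon i j k l)%:~R.
Proof.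
rewrite /levi_civita /epsilon.
pose M := \matrix_(a < 4, b < 4) (tnth [tuple i; j; k; l] a == b)%:Z.
rewrite (_ : det4 _ = \det M); last first.
  by rewrite det_mx44 /det4 /M !mxE.
rewrite -det_map_mx; congr (\det _); apply/matrixP => a b; rewrite !mxE.
by case: (_ == _).
Qed.

(** The Hodge star of the Euclidean metric, for the standard orientation. *)
Definition hodge_dual (R : realType) (alpha : 'M[R]_4) : 'M[R]_4 :=
  \matrix_(k, l) (2^-1 * \sum_(i < 4) \sum_(j < 4)
     levi_civita R i j k l * alpha i j).

Ltac eval_epsilon :=
  repeat match goal with |- context [epsilon ?i ?j ?k ?l] =>
    let v := eval vm_compute in (epsilon i j k l) in
    change (epsilon i j k l) with v end.

Lemma hodge_dual_entries (R : realType) (al : 'M[R]_4) : al^T = - al ->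
  let d := hodge_dual al in
  [/\ d^T = - d, d o0 o1 = al o2 o3, d o2 o3 = al o0 o1 &
   [/\ d o0 o2 = - al o1 o3, d o1 o3 = - al o0 o2,
       d o0 o3 = al o1 o2 & d o1 o2 = al o0 o3]].
Proof.
move=> skew d.
have sk a b : al b a = - al a b by rewrite -trmx_entry skew mxE.
have z a : al a a = 0 by have := sk a a; lra.
have p1 : (Posz 1)%:~R = 1 :> R by [].
have p0 : (Posz 0)%:~R = 0 :> R by [].
have n1 : (Negz 0)%:~R = - 1 :> R by [].
have dE k l : d k l = 2^-1 * \sum_(i < 4) \sum_(j < 4)
     (epsilon i j k l)%:~R * al i j.
  rewrite mxE; congr (_ * _); apply: eq_bigr => i _; apply: eq_bigr => j _.
  by rewrite levi_civitaE.
have dC k l : d l k = - d k l.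
  rewrite !dE -mulrN -sumrN; congr (_ * _); apply: eq_bigr => i _.
  rewrite -sumrN; apply: eq_bigr => j _; rewrite -mulNr; congr (_ * _).
  elim/ord4_ind: k; elim/ord4_ind: l; elim/ord4_ind: i; elim/ord4_ind: j;
    by eval_epsilon; rewrite ?(p1, p0, n1, oppr0, opprK).
split; [by apply/matrixP => a b; rewrite trmx_entry dC [RHS]mxE| | |split].
all: by rewrite dE !big_ord4; eval_epsilon; rewrite !(p1, p0, n1)
  ?(sk o0 o1) ?(sk o0 o2) ?(sk o0 o3) ?(sk o1 o2) ?(sk o1 o3) ?(sk o2 o3); field.
Qed.

(** The Levi-Civita symbol contracted with four copies of [P] gains the factor [\det P]. Each entry
    is a polynomial identity in [P] and the six independent entries of [al]. *)
Lemma hodge_dual_congr (R : realType) (P al : 'M[R]_4) : al^T = - al ->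
  P *m hodge_dual (P^T *m al *m P) *m P^T = \det P *: hodge_dual al.
Proof.
move=> skew.
have skb : (P^T *m al *m P)^T = - (P^T *m al *m P).
  by rewrite !trmx_mul trmxK skew !(mulmxN, mulNmx) mulmxA.
have [dT d01 d23 [d02 d13 d03 d12]] := hodge_dual_entries skb.
have [eT e01 e23 [e02 e13 e03 e12]] := hodge_dual_entries skew.
move: dT d01 d23 d02 d13 d03 d12 eT e01 e23 e02 e13 e03 e12.
move: (hodge_dual al) (hodge_dual _) => e d.
move=> dT d01 d23 d02 d13 d03 d12 eT e01 e23 e02 e13 e03 e12.
have sk (A : 'M[R]_4) : A^T = - A ->
    (forall a b, A b a = - A a b) /\ forall a, A a a = 0.
  move=> AT; have h a b : A b a = - A a b by rewrite -trmx_entry AT mxE.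
  by split=> // a; have := h a a; lra.
have [ds dz] := sk d dT; have [es ez] := sk e eT; have [als alz] := sk al skew.
have PdE k l : (P *m d *m P^T) k l =
    \sum_(a < 4) \sum_(b < 4) P k b * d b a * P l a.
  rewrite mxE; apply: eq_bigr => a _; rewrite trmx_entry mxE mulr_suml.
  by apply: eq_bigr.
have bE k l : (P^T *m al *m P) k l =
    \sum_(a < 4) \sum_(b < 4) P b k * al b a * P a l.
  rewrite mxE; apply: eq_bigr => a _; rewrite mxE mulr_suml.
  by apply: eq_bigr => b _; rewrite trmx_entry.
apply/matrixP => k l; rewrite PdE mxE det_mx44 /det4 !big_ord4.
rewrite !dz (ds o0 o1) (ds o0 o2) (ds o0 o3) (ds o1 o2) (ds o1 o3) (ds o2 o3).
rewrite d01 d23 d02 d13 d03 d12 !bE !big_ord4.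
rewrite !alz (als o0 o1) (als o0 o2) (als o0 o3) (als o1 o2) (als o1 o3) (als o2 o3).
elim/ord4_ind: k; elim/ord4_ind: l;
rewrite ?ez ?(es o0 o1) ?(es o0 o2) ?(es o0 o3) ?(es o1 o2) ?(es o1 o3) ?(es o2 o3);
rewrite ?e01 ?e23 ?e02 ?e13 ?e03 ?e12.
all: ring.
Qed.

Definition gram (R : realType) (G : 'M[R]_4) (v w : 'rV[R]_4) : R :=
  (v *m G *m w^T) 0 0.

Lemma gram_row (R : realType) (G P : 'M[R]_4) a b :
  (P *m G *m P^T) a b = gram G (row a P) (row b P).
Proof.
rewrite /gram -row_mul mxE [RHS]mxE; apply: eq_bigr => k _.
by congr (_ * _); rewrite ?trmx_entry [RHS]mxE.
Qed.

Section UnitaryFrame.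
Context (R : realType) (G : 'M[R]_4).
Context (Gsym : G^T = G)
  (Gpos : forall v : 'rV[R]_4, v != 0 -> 0 < (v *m G *m v^T) 0 0)
  (Gherm : J0 R *m G *m (J0 R)^T = G).

Let J := J0 R.
Let ip := gram G.

Lemma gramC v w : ip v w = ip w v.
Proof. by rewrite /ip /gram -trmx_entry !trmx_mul trmxK Gsym mulmxA. Qed.

Lemma gramZ c d v w : ip (c *: v) (d *: w) = c * d * ip v w.
Proof.
rewrite /ip /gram linearZ /= -!scalemxAl -scalemxAr !mxE.
by rewrite mulrA.
Qed.

Lemma gram_J v w : ip (v *m J) (w *m J) = ip v w.
Proof.
rewrite /ip /gram -[in RHS]Gherm trmx_mul !mulmxA //.
Qed.

Lemma gram_Jl v w : ip (v *m J) w = - ip v (w *m J).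
Proof.
rewrite -(gram_J (v *m J) w) -mulmxA J0_sqr mulmxN mulmx1 -scaleN1r.
by rewrite -[in LHS](scale1r (w *m J)) gramZ mulr1 mulN1r.
Qed.

Lemma gram_vJ v : ip v (v *m J) = 0.
Proof. by have := gram_Jl v v; rewrite gramC; lra. Qed.

Lemma gram_normalize v : v != 0 -> exists2 c, c != 0 & ip (c *: v) (c *: v) = 1.
Proof.
move=> /Gpos v0; exists (Num.sqrt (ip v v))^-1.
  by rewrite invr_eq0 sqrtr_eq0 -ltNge.
rewrite gramZ -invfM -expr2 sqr_sqrtr ?ltW // mulVf // gt_eqF //.
Qed.

Lemma gram_orthogonal u v : exists2 w, w != 0 & ip w u = 0 /\ ip w v = 0.
Proof.
pose M := row_mx (G *m u^T) (G *m v^T).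
have : kermx M != 0.
  rewrite -mxrank_eq0 mxrank_ker -lt0n subn_gt0.
  by apply: leq_ltn_trans (rank_leq_col M) _.
case/rowV0Pn => w /sub_kermxP wM w0; exists w => //.
move: wM; rewrite /M mul_mx_row => /eqP; rewrite -row_mx0 => /eqP/eq_row_mx[a b].
by rewrite /ip /gram -!mulmxA a b !mxE.
Qed.

(** Gram-Schmidt over the complex numbers: the rows are u, Ju, w, Jw with [w] orthogonal to u and
    Ju, and hermitian symmetry gives the other orthogonality relations. Commutation with [J] says
    that the rows come in such pairs. *)
Lemma unitary_frame : exists P : 'M[R]_4,
  P *m G *m P^T = 1%:M /\ P *m J = J *m P.
Proof.
have e0 : (delta_mx 0 o0 : 'rV[R]_4) != 0.
  apply/eqP => /matrixP /(_ 0 o0); rewrite !mxE !eqxx /= => /eqP.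
  by rewrite oner_eq0.
have [c _ uu] := gram_normalize e0; set u := c *: _ in uu.
have [w' w0 [wu wuJ]] := gram_orthogonal u (u *m J).
have [d _ ww] := gram_normalize w0; set w := d *: w' in ww.
have {}wu : ip w u = 0.
  by rewrite /w -[u]scale1r gramZ wu mulr0.
have {}wuJ : ip w (u *m J) = 0.
  by rewrite /w -[u *m J]scale1r gramZ wuJ mulr0.
pose e a := tnth [tuple u; u *m J; w; w *m J] a.
have rowP_e a : row a (\matrix_a e a) = e a by rewrite rowK.
exists (\matrix_a e a); split.
  apply/matrixP => a b; rewrite gram_row !rowP_e -/ip mxE.
  have uw : ip u w = 0 by rewrite gramC.
  have uwJ : ip u (w *m J) = 0 by have := gram_Jl u w; rewrite gramC wuJ; lra.
  elim/ord4_ind: a; elim/ord4_ind: b; rewrite /e /= ?uu ?ww ?gram_vJ ?wu ?wuJ //;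
    by rewrite ?gram_J // gramC ?gram_vJ ?wuJ ?wu.
apply/row_matrixP => a; rewrite row_mul rowP_e; apply/rowP => b.
rewrite [RHS]mxE mul_J0mx.
have -> : (\matrix_a e a) (J_index a) b = e (J_index a) 0 b by rewrite mxE.
by elim/ord4_ind: a; rewrite /e /J_sign /= ?expr0 ?expr1 ?mul1r //;
  rewrite -mulmxA J0_sqr mulmxN mulmx1 mxE mulN1r.
Qed.

End UnitaryFrame.

(** A real matrix commuting with [J0] is a complex 2x2 matrix, and its determinant is the squared
    modulus of the complex determinant, whose real and imaginary parts are squared in the proof. *)
Lemma det_unitary_ge0 (R : realType) (P : 'M[R]_4) :
  P *m J0 R = J0 R *m P -> 0 <= \det P.
Proof.
move=> PJ.
have h a b : P (J_index a) b = - (J_sign R a * J_sign R b) * P a (J_index b).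
  have : (P *m J0 R) a b = (J0 R *m P) a b by rewrite PJ.
  rewrite mulmx_J0 mul_J0mx => E; have s2 : J_sign R a * J_sign R a = 1.
    by rewrite /J_sign -expr2 sqrr_sign.
  by rewrite -[LHS]mul1r -s2 -mulrA -E; ring.
have h1 b := h o0 b; have h3 b := h o2 b; rewrite /= in h1 h3.
have Jo : (J_index o0 = o1) * (J_index o1 = o0) * (J_index o2 = o3) * (J_index o3 = o2) by [].
have S0 : J_sign R o0 = 1 by rewrite /J_sign expr0.
have S1 : J_sign R o1 = -1 by rewrite /J_sign expr1.
have S2 : J_sign R o2 = 1 by rewrite /J_sign expr0.
have S3 : J_sign R o3 = -1 by rewrite /J_sign expr1.
rewrite !Jo in h1 h3.
rewrite det_mx44 /det4 !h1 !h3 !Jo S0 S1 S2 S3.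
rewrite [leRHS](_ : _ =
  (P o0 o0 * P o2 o2 - P o0 o1 * P o2 o3 - P o0 o2 * P o2 o0 + P o0 o3 * P o2 o1) ^+ 2
  + (P o0 o0 * P o2 o3 + P o0 o1 * P o2 o2 - P o0 o2 * P o2 o1 - P o0 o3 * P o2 o0) ^+ 2).
  by rewrite addr_ge0 ?sqr_ge0.
by ring.
Qed.

(** * Algebraic Kaehler curvature tensors *)

Notation q0 := (@Ordinal 3 0 isT).
Notation q1 := (@Ordinal 3 1 isT).
Notation q2 := (@Ordinal 3 2 isT).

Lemma ord3_ind (P : 'I_3 -> Prop) : P q0 -> P q1 -> P q2 -> forall a, P a.
Proof.
by move=> p0 p1 p2 [[|[|[|]]] h] //; rewrite (bool_irrelevance h isT).
Qed.

Lemma big_ord3 (R : nmodType) (F : 'I_3 -> R) :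
  \sum_(a < 3) F a = F q0 + F q1 + F q2.
Proof.
rewrite !big_ord_recl big_ord0 addr0 !addrA.
by congr (F _ + F _ + F _); exact: val_inj.
Qed.

(** The components of a [kahler_curvature] in a unitary frame, where J permutes the frame vectors up
    to the signs [J_sign]. *)
Record kahler_tensor (R : realType) (r : 'I_4 -> 'I_4 -> 'I_4 -> 'I_4 -> R) : Prop := {
  kt_skew12 : forall a b c d, r b a c d = - r a b c d;
  kt_skew34 : forall a b c d, r a b d c = - r a b c d;
  kt_bianchi : forall a b c d, r a b c d + r b d c a + r d a c b = 0;
  kt_J : forall a b c d,
    J_sign R c * J_sign R d * r a b (J_index c) (J_index d) = r a b c d
}.

Section KahlerTensor.
Context (R : realType) (r : 'I_4 -> 'I_4 -> 'I_4 -> 'I_4 -> R).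
Context (kr : kahler_tensor r).

(** The octahedron argument: four Bianchi identities and the skew symmetries form a linear system in
    24 components, which forces pair exchange. *)
Lemma kt_pair a b c d : r a b c d = r c d a b.
Proof.
have [s12 s34 bi _] := kr.
have := bi a b c d; have := bi b c d a; have := bi c d a b; have := bi d a b c.
move: (s12 a b c d) (s34 c d a b) (s12 a b d c) (s34 d c a b) (s12 a c b d)
  (s34 b d a c) (s12 a c d b) (s34 d b a c) (s12 a d b c) (s34 b c a d) (s12 a
  d c b) (s34 c b a d) (s12 b c a d) (s34 a d b c) (s12 b c d a) (s34 d a b c)
  (s12 b d a c) (s34 a c b d) (s12 b d c a) (s34 c a b d) (s12 c d a b) (s34 a
  b c d) (s12 c d b a) (s34 b a c d).
move: (r a b c d) (r a b d c) (r b a c d) (r b a d c)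
  (r a c b d) (r a c d b) (r c a b d) (r c a d b)
  (r a d b c) (r a d c b) (r d a b c) (r d a c b)
  (r b c a d) (r b c d a) (r c b a d) (r c b d a)
  (r b d a c) (r b d c a) (r d b a c) (r d b c a)
  (r c d a b) (r c d b a) (r d c a b) (r d c b a).
by move=> *; lra.
Qed.

Lemma kt_diag12 a c d : r a a c d = 0.
Proof. by have := kt_skew12 kr a a c d; lra. Qed.

Lemma kt_diag34 a b c : r a b c c = 0.
Proof. by have := kt_skew34 kr a b c c; lra. Qed.

Lemma kt34_02 a b : r a b o1 o3 = r a b o0 o2.
Proof.
by rewrite -(kt_J kr a b o0 o2) /J_sign !expr0 !mul1r.
Qed.

Lemma kt34_03 a b : r a b o1 o2 = - r a b o0 o3.
Proof.
by rewrite -(kt_J kr a b o0 o3) /J_sign expr0 expr1 mul1r mulN1r opprK.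
Qed.

Lemma kt12_02 c d : r o1 o3 c d = r o0 o2 c d.
Proof. by rewrite kt_pair kt34_02 kt_pair. Qed.

Lemma kt12_03 c d : r o1 o2 c d = - r o0 o3 c d.
Proof. by rewrite kt_pair kt34_03 kt_pair. Qed.

(* By [kt12_02] and [kt12_03] every pair of indices reduces to 01, 23, 02 or
   03; the symmetric 4x4 block that remains has one further relation,
   [kt_bianchi0123]. *)
Definition kt_norm12 c d := (kt_diag12, kt_skew12 kr o0 o1 c d,
  kt_skew12 kr o0 o2 c d, kt_skew12 kr o0 o3 c d, kt_skew12 kr o2 o3 c d,
  kt_skew12 kr o1 o3 c d, kt_skew12 kr o1 o2 c d, kt12_02, kt12_03).

Definition kt_norm34 a b := (kt_diag34, kt_skew34 kr a b o0 o1,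
  kt_skew34 kr a b o0 o2, kt_skew34 kr a b o0 o3, kt_skew34 kr a b o2 o3,
  kt_skew34 kr a b o1 o3, kt_skew34 kr a b o1 o2, kt34_02, kt34_03).

Definition kt_norm_pair := (kt_pair o2 o3 o0 o1, kt_pair o0 o2 o0 o1,
  kt_pair o0 o3 o0 o1, kt_pair o0 o2 o2 o3, kt_pair o0 o3 o2 o3,
  kt_pair o0 o3 o0 o2).

Lemma kt_bianchi0123 : r o0 o1 o2 o3 = r o0 o2 o0 o2 + r o0 o3 o0 o3.
Proof.
have := kt_bianchi kr o0 o1 o2 o3.
by rewrite !kt_norm12 !kt_norm34; lra.
Qed.

(** [q a b c d] is R(e_a, J e_b, e_c, J e_d). The three pairings contribute 2s, s and s: the first
    evaluates R on twice the Kähler bivector, the second is [s] because J permutes the frame up to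
    sign, and J-invariance turns the third into the second. *)
Lemma kt_average (s : R) :
  s = \sum_(a < 4) \sum_(b < 4) r a b a b ->
  let q a b c d := J_sign R b * J_sign R d * r a (J_index b) c (J_index d) in
  \sum_(a < 4) \sum_(b < 4) (q a a b b + q a b a b + q a b b a) = 4 * s.
Proof.
move=> -> q.
have S0 : J_sign R o0 = 1 by rewrite /J_sign expr0.
have S1 : J_sign R o1 = -1 by rewrite /J_sign expr1.
have S2 : J_sign R o2 = 1 by rewrite /J_sign expr0.
have S3 : J_sign R o3 = -1 by rewrite /J_sign expr1.
rewrite !big_ord4 /q !(S0, S1, S2, S3) /=.
have Jo : (J_index o0 = o1) * (J_index o1 = o0) * (J_index o2 = o3) * (J_index o3 = o2) by [].
rewrite !Jo !kt_norm12 ?kt_norm34 ?kt_norm_pair kt_bianchi0123.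
by ring.
Qed.

(** The pairing of a J-invariant skew form with y /\ Jy, where J-invariance folds the index pairs 13
    and 12 into 02 and 03. It serves for both index pairs of the curvature. *)
Lemma complex_bivector_sum (y : 'rV[R]_4) (m : 'I_4 -> 'I_4 -> R) :
  (forall a b, m b a = - m a b) -> m o1 o3 = m o0 o2 -> m o1 o2 = - m o0 o3 ->
  \sum_(a < 4) y 0 a * \sum_(b < 4) (y *m J0 R) 0 b * m a b =
  (y 0 o0 ^+ 2 + y 0 o1 ^+ 2) * m o0 o1 + (y 0 o2 ^+ 2 + y 0 o3 ^+ 2) * m o2 o3
  + 2 * (y 0 o1 * y 0 o2 - y 0 o0 * y 0 o3) * m o0 o2
  + 2 * (y 0 o0 * y 0 o2 + y 0 o1 * y 0 o3) * m o0 o3.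
Proof.
move=> sk m13 m12.
have z a : m a a = 0 by have := sk a a; lra.
have S0 : J_sign R o0 = 1 by rewrite /J_sign expr0.
have S1 : J_sign R o1 = -1 by rewrite /J_sign expr1.
have S2 : J_sign R o2 = 1 by rewrite /J_sign expr0.
have S3 : J_sign R o3 = -1 by rewrite /J_sign expr1.
have Jo : (J_index o0 = o1) * (J_index o1 = o0) * (J_index o2 = o3) * (J_index o3 = o2) by [].
rewrite !big_ord4 !mulmx_J0 !(S0, S1, S2, S3) !Jo !z.
rewrite (sk o0 o1) (sk o0 o2) (sk o0 o3) (sk o1 o2) (sk o1 o3) (sk o2 o3) m13 m12.
by ring.
Qed.

(** Pairings with e01 - e23, e02 + e13 and e03 - e12. These have squared norm 2, whence the factors
    [2^-1] in [weyl_mx] and [asd_projection]. *)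
Definition asd_coord (m : 'I_4 -> 'I_4 -> R) (k : 'I_3) : R :=
  tnth [tuple m o0 o1 - m o2 o3; m o0 o2 + m o1 o3; m o0 o3 - m o1 o2] k.

Lemma asd_coordE m :
  (asd_coord m q0 = m o0 o1 - m o2 o3) * (asd_coord m q1 = m o0 o2 + m o1 o3)
  * (asd_coord m q2 = m o0 o3 - m o1 o2).
Proof. by []. Qed.

(* The matrix of [W^-] in the basis [e01 - e23], [e02 + e13], [e03 - e12]. *)
Definition weyl_mx (s : R) : 'M[R]_3 := \matrix_(k, l)
  (2^-1 * asd_coord (fun c d => asd_coord (fun a b => r a b c d) k) l
   - s / 12 * (k == l)%:R).

Lemma weyl_mxE s k l : weyl_mx s k l =
  2^-1 * asd_coord (fun c d => asd_coord (fun a b => r a b c d) k) l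
  - s / 12 * (k == l)%:R.
Proof. by rewrite mxE. Qed.

(* For a unit vector [y], the bivector [y /\ J y] is half of
   [(e01 + e23) + hopf_0 (e01 - e23) + hopf_1 (e02 + e13) + hopf_2 (e03 - e12)]. *)
Definition hopf (y : 'rV[R]_4) : 'rV[R]_3 :=
  \row_k tnth [tuple y 0 o0 ^+ 2 + y 0 o1 ^+ 2 - y 0 o2 ^+ 2 - y 0 o3 ^+ 2;
    2 * (y 0 o1 * y 0 o2 - y 0 o0 * y 0 o3);
    2 * (y 0 o0 * y 0 o2 + y 0 o1 * y 0 o3)] k.

Lemma hopfE y :
  (hopf y 0 q0 = y 0 o0 ^+ 2 + y 0 o1 ^+ 2 - y 0 o2 ^+ 2 - y 0 o3 ^+ 2) *
  (hopf y 0 q1 = 2 * (y 0 o1 * y 0 o2 - y 0 o0 * y 0 o3)) *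
  (hopf y 0 q2 = 2 * (y 0 o0 * y 0 o2 + y 0 o1 * y 0 o3)).
Proof. by rewrite !mxE. Qed.

Lemma weyl_mx_sym s : (weyl_mx s)^T = weyl_mx s.
Proof.
apply/matrixP => k l; rewrite trmx_entry !mxE eq_sym; congr (_ * _ - _).
elim/ord3_ind: k; elim/ord3_ind: l => //; rewrite !asd_coordE;
  by rewrite ?kt_norm12 ?kt_norm34 ?kt_norm_pair //; ring.
Qed.

Lemma hol_quartic (s : R) (y : 'rV[R]_4) :
  (forall b c, \sum_(a < 4) r a b a c = (b == c)%:R * (s / 4)) ->
  y 0 o0 ^+ 2 + y 0 o1 ^+ 2 + y 0 o2 ^+ 2 + y 0 o3 ^+ 2 = 1 ->
  \sum_(a < 4) y 0 a * \sum_(b < 4) (y *m J0 R) 0 b *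
    \sum_(c < 4) y 0 c * \sum_(d < 4) (y *m J0 R) 0 d * r a b c d =
  s / 6 + (hopf y *m weyl_mx s *m (hopf y)^T) 0 0 / 2.
Proof.
move=> ein y1.
have in34 a b := complex_bivector_sum y (kt_skew34 kr a b) (kt34_02 a b) (kt34_03 a b).
rewrite complex_bivector_sum; first last.
- by rewrite !in34 !kt_norm12; ring.
- by rewrite !in34 !kt_norm12; ring.
- by move=> a b; rewrite !in34 !(kt_skew12 kr a b); ring.
rewrite !in34 ?kt_norm_pair.
have e00 := ein o0 o0; have e22 := ein o2 o2; have e02 := ein o0 o2; have e03 := ein o0 o3.
rewrite !big_ord4 /= !kt_norm12 ?kt_norm34 ?kt_norm_pair in e00 e22 e02 e03.
rewrite (_ : (hopf y *m weyl_mx s *m (hopf y)^T) 0 0 =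
  \sum_k \sum_l hopf y 0 l * weyl_mx s l k * hopf y 0 k); last first.
  rewrite mxE; apply: eq_bigr => k _; rewrite trmx_entry mxE mulr_suml.
  by apply: eq_bigr => l _.
rewrite !big_ord3 !hopfE !weyl_mxE !asd_coordE /=.
rewrite !kt_norm12 ?kt_norm34 ?kt_norm_pair kt_bianchi0123.
(* Multiplying by |y|^4 = 1 makes both sides quartic forms in [y], which then agree as
   polynomials. *)
have -> : s / 6 = s / 6 *
    (y 0 o0 ^+ 2 + y 0 o1 ^+ 2 + y 0 o2 ^+ 2 + y 0 o3 ^+ 2) ^+ 2.
  by rewrite y1 expr1n mulr1.
move: e00 e22 e02 e03 => {y1 in34}.
move: (r o0 o1 o0 o1) (r o2 o3 o2 o3) (r o0 o2 o0 o2) (r o0 o3 o0 o3) => k11 k22 k33 k44.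
move: (r o0 o1 o0 o2) (r o0 o1 o0 o3) (r o0 o2 o0 o3) => k13 k14 k34.
move: (r o2 o3 o0 o2) (r o2 o3 o0 o3) => k23 k24.
move: (y 0 o0) (y 0 o1) (y 0 o2) (y 0 o3) => y0 y1 y2 y3 e00 e22 e02 e03.
(* These three equalities are R(omega, phi) = 0 for phi = e01 - e23, e03 - e12 and e02 + e13, in
   this order. *)
have -> : k22 = k11 by lra.
have -> : k24 = - k14 by lra.
have -> : k23 = - k13 by lra.
have -> : s = 4 * (k11 + k33 + k44) by lra.
by field.
Qed.
End KahlerTensor.

Lemma linear_functionalZ (R : pzRingType) (f : 'rV[R]_4 -> R) :
  linear_functional f -> forall c X, f (c *: X) = c * f X.
Proof.
move=> lf c X.
have f0 : f 0 = 0.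
  by have := lf (-1) 0 0; rewrite scaler0 addr0 mulN1r addNr.
by rewrite -[c *: X]addr0 lf f0 addr0.
Qed.

(** * Anti-self-dual forms as coordinate vectors in the basis e01 - e23, e02 + e13, e03 - e12 *)

Definition asd_mx (R : nzRingType) (u : 'rV[R]_3) : 'M[R]_4 :=
  let z := 0 in let a := u 0 q0 in let b := u 0 q1 in let c := u 0 q2 in
  \matrix_(k, l) tnth (tnth [tuple [tuple z; a; b; c]; [tuple - a; z; - c; b];
    [tuple - b; c; z; - a]; [tuple - c; - b; a; z]] k) l.

Lemma asd_mxE (R : nzRingType) (u : 'rV[R]_3) :
  (asd_mx u o0 o1 = u 0 q0) * (asd_mx u o2 o3 = - u 0 q0) *
  (asd_mx u o0 o2 = u 0 q1) * (asd_mx u o1 o3 = u 0 q1) *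
  (asd_mx u o0 o3 = u 0 q2) * (asd_mx u o1 o2 = - u 0 q2).
Proof. by rewrite !mxE. Qed.

Lemma row3E (R : Type) (a b c : R) :
  ((\row_k tnth [tuple a; b; c] k) 0 q0 = a) *
  ((\row_k tnth [tuple a; b; c] k) 0 q1 = b) *
  ((\row_k tnth [tuple a; b; c] k) 0 q2 = c).
Proof. by rewrite !mxE. Qed.

Lemma skew_mx4_eq (R : realDomainType) (A B : 'M[R]_4) :
  A^T = - A -> B^T = - B ->
  A o0 o1 = B o0 o1 -> A o2 o3 = B o2 o3 -> A o0 o2 = B o0 o2 ->
  A o1 o3 = B o1 o3 -> A o0 o3 = B o0 o3 -> A o1 o2 = B o1 o2 -> A = B.
Proof.
have sk (C : 'M[R]_4) : C^T = - C ->
    (forall a b, C b a = - C a b) /\ forall a, C a a = 0.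
  move=> CT; have h a b : C b a = - C a b by rewrite -trmx_entry CT mxE.
  by split=> // a; have := h a a; lra.
move=> /sk[sA zA] /sk[sB zB] e01 e23 e02 e13 e03 e12; apply/matrixP => k l.
elim/ord4_ind: k; elim/ord4_ind: l; rewrite ?zA ?zB //.
all: by rewrite sA [RHS]sB ?e01 ?e23 ?e02 ?e13 ?e03 ?e12.
Qed.

Lemma asd_mx_tr (R : nzRingType) (u : 'rV[R]_3) : (asd_mx u)^T = - asd_mx u.
Proof.
apply/matrixP => k l; elim/ord4_ind: k; elim/ord4_ind: l;
  by rewrite !mxE /= ?oppr0 ?opprK.
Qed.

Lemma asd_mx_linear (R : nzRingType) c (u v : 'rV[R]_3) :
  asd_mx (c *: u + v) = c *: asd_mx u + asd_mx v.
Proof.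
apply/matrixP => k l; elim/ord4_ind: k; elim/ord4_ind: l;
  by rewrite !mxE /= ?mulr0 ?addr0 ?opprD ?mulrN.
Qed.

Lemma asd_mxZ (R : nzRingType) c (u : 'rV[R]_3) : asd_mx (c *: u) = c *: asd_mx u.
Proof.
apply/matrixP => k l; elim/ord4_ind: k; elim/ord4_ind: l;
  by rewrite !mxE /= ?mulr0 ?mulrN.
Qed.

Lemma asd_mx_sum (R : nzRingType) n (c : 'I_n -> R) (u : 'I_n -> 'rV[R]_3) :
  asd_mx (\sum_i c i *: u i) = \sum_i c i *: asd_mx (u i).
Proof.
elim/big_rec2: _ => [|i y z _ <-]; last by rewrite asd_mx_linear.
by rewrite -[X in asd_mx X](scale0r 0) asd_mxZ scale0r.
Qed.

Lemma asd_mx_inj (R : nzRingType) : injective (@asd_mx R).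
Proof.
move=> u v /matrixP E; apply/rowP; elim/ord3_ind.
- by have := E o0 o1; rewrite !mxE.
- by have := E o0 o2; rewrite !mxE.
- by have := E o0 o3; rewrite !mxE.
Qed.

Lemma asd_mxP (R : realType) (be : 'M[R]_4) : be^T = - be ->
  be o2 o3 = - be o0 o1 -> be o1 o3 = be o0 o2 -> be o1 o2 = - be o0 o3 ->
  be = asd_mx (\row_k tnth [tuple be o0 o1; be o0 o2; be o0 o3] k).
Proof.
move=> skew b23 b13 b12.
apply: skew_mx4_eq skew (asd_mx_tr _) _ _ _ _ _ _;
  by rewrite asd_mxE ?row3E ?b23 ?b13 ?b12.
Qed.

Lemma hodge_dual_asd (R : realType) (u : 'rV[R]_3) :
  hodge_dual (asd_mx u) = - asd_mx u.
Proof.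
have [dT d01 d23 [d02 d13 d03 d12]] := hodge_dual_entries (asd_mx_tr u).
have nT : (- asd_mx u)^T = - - asd_mx u by rewrite linearN /= asd_mx_tr.
apply: skew_mx4_eq dT nT _ _ _ _ _ _.
all: by rewrite ?d01 ?d23 ?d02 ?d13 ?d03 ?d12 [RHS]mxE !asd_mxE ?opprK.
Qed.

Lemma asd_projection (R : realType) (be : 'M[R]_4) : be^T = - be ->
  2^-1 *: (be - hodge_dual be) = asd_mx (\row_k (2^-1 * asd_coord be k)).
Proof.
move=> skew.
have [dT d01 d23 [d02 d13 d03 d12]] := hodge_dual_entries skew.
have e a b : (2^-1 *: (be - hodge_dual be)) a b = 2^-1 * (be a b - hodge_dual be a b).
  by rewrite mxE mx_entryB.
have re k : (\row_k (2^-1 * asd_coord be k)) 0 k = 2^-1 * asd_coord be k by rewrite mxE.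
apply: skew_mx4_eq _ (asd_mx_tr _) _ _ _ _ _ _; rewrite ?e ?asd_mxE ?re.
- by rewrite linearZ linearB /= skew dT -scalerN opprB opprK addrC.
all: by rewrite asd_coordE ?d01 ?d23 ?d02 ?d13 ?d03 ?d12; ring.
Qed.

Lemma asd_contraction (R : realType) (u : 'rV[R]_3) (m : 'I_4 -> 'I_4 -> R) :
  (forall a b, m b a = - m a b) ->
  2^-1 * (\sum_a \sum_b asd_mx u a b * m a b) = \sum_k u 0 k * asd_coord m k.
Proof.
move=> sk; have z a : m a a = 0 by have := sk a a; lra.
have [skA zA] : (forall a b, asd_mx u b a = - asd_mx u a b) /\
    forall a, asd_mx u a a = 0.
  have h a b : asd_mx u b a = - asd_mx u a b by rewrite -trmx_entry asd_mx_tr mxE.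
  by split=> // a; have := h a a; lra.
rewrite !big_ord4 big_ord3 !asd_coordE !z !zA.
rewrite (skA o0 o1) (skA o0 o2) (skA o0 o3) (skA o1 o2) (skA o1 o3) (skA o2 o3).
rewrite !asd_mxE.
rewrite (sk o0 o1) (sk o0 o2) (sk o0 o3) (sk o1 o2) (sk o1 o3) (sk o2 o3).
by field.
Qed.

(** * Ricci curvature, Hodge star and W^- in a unitary frame *)

Section FrameForms.
Context (R : realType) (g : 'rV[R]_4 -> 'M[R]_4) (x : 'rV[R]_4) (P : 'M[R]_4).
Context (kc : kahler_curvature (curvature g x)) (gsym : (g x)^T = g x)
  (gunit : g x \in unitmx)
  (Pg : P *m g x *m P^T = 1%:M) (PJ : P *m J0 R = J0 R *m P).

Definition frame_curv (a b c d : 'I_4) : R :=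
  curvature g x (row a P) (row b P) (row c P) (row d P).
Let r := frame_curv.

Lemma frame_unit : P \in unitmx.
Proof. by have [] := mulmx1_unit (etrans (mulmxA _ _ _) Pg). Qed.

Lemma frame_gram_inv : invmx (g x) = P^T *m P.
Proof.
have h : P^T *m P *m g x = 1%:M.
  rewrite -mulmxA; apply: mulmx1C.
  by rewrite -Pg.
by rewrite -[RHS]mulmx1 -(mulmxV gunit) mulmxA h mul1mx.
Qed.

Lemma frame_inner y z : inner g x (y *m P) (z *m P) = (y *m z^T) 0 0.
Proof.
by rewrite /inner trmx_mul !mulmxA -(mulmxA y) -(mulmxA y) Pg mulmx1.
Qed.

Lemma row_frame_J0 a : row a P *m J0 R = J_sign R a *: row (J_index a) P.
Proof.
rewrite -row_mul PJ; apply/rowP => b.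
by rewrite mxE mul_J0mx [RHS]mxE [X in _ = _ * X]mxE.
Qed.

Lemma frame_kahler_tensor : kahler_tensor r.
Proof.
split=> *; rewrite /r /frame_curv.
- exact: kc_skew12.
- exact: kc_skew34.
- exact: kc_bianchi.
- rewrite -[RHS](kc_J kc) !row_frame_J0.
  rewrite (linear_functionalZ (kc_linear4 kc _ _ _)).
  by rewrite (linear_functionalZ (kc_linear3 kc _ _ _)) mulrA [in RHS](mulrC (J_sign R _)).
Qed.

Lemma curvature_frame y z w v :
  curvature g x (y *m P) (z *m P) (w *m P) (v *m P) =
  \sum_a y 0 a * \sum_b z 0 b * \sum_c w 0 c * \sum_d v 0 d * r a b c d.
Proof.
rewrite (linear_functional_frame (kc_linear1 kc _ _ _)).
apply: eq_bigr => a _; congr (_ * _).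
rewrite (linear_functional_frame (kc_linear2 kc _ _ _)).
apply: eq_bigr => b _; congr (_ * _).
rewrite (linear_functional_frame (kc_linear3 kc _ _ _)).
apply: eq_bigr => c _; congr (_ * _).
by rewrite (linear_functional_frame (kc_linear4 kc _ _ _)).
Qed.

Lemma hol_curv_frame y : hol_curv g x (y *m P) =
  \sum_a y 0 a * \sum_b (y *m J0 R) 0 b *
    \sum_c y 0 c * \sum_d (y *m J0 R) 0 d * r a b c d.
Proof. by rewrite /hol_curv -mulmxA PJ mulmxA curvature_frame. Qed.

Lemma frame_curvE a b c d : r a b c d = \sum_i \sum_j P a i * P b j *
  (P *m (curvature_mx g i j x *m g x) *m P^T) d c.
Proof.
rewrite /r /frame_curv curvature_matrix.
apply: eq_bigr => i _; apply: eq_bigr => j _.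
by rewrite (gram_row (curvature_mx g i j x *m g x)) /gram; congr (_ * _ * _); rewrite mxE.
Qed.

(** The trace in [ricci] runs over coordinate vectors; inserting [g x *m P^T *m P = 1%:M] turns it
    into a sum over the orthonormal frame. *)
Lemma frame_ricci b c : \sum_a r a b a c = (P *m ricci g x *m P^T) b c.
Proof.
transitivity (\sum_i \sum_j P b j * (P *m curvature_mx g i j x) c i).
  under eq_bigr => a _ do rewrite frame_curvE.
  rewrite exchange_big; apply: eq_bigr => i _.
  rewrite exchange_big; apply: eq_bigr => j _.
  have -> : P *m curvature_mx g i j x =
      P *m (curvature_mx g i j x *m g x) *m P^T *m P.
    by rewrite -!mulmxA -frame_gram_inv mulmxV // mulmx1.
  rewrite [in RHS]mxE mulr_sumr; apply: eq_bigr => a _.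
  by rewrite -mulrA mulrCA [P a i * _]mulrC.
rewrite exchange_big mxE.
transitivity (\sum_k \sum_j P b j * P c k * ricci g x j k).
  rewrite [RHS]exchange_big; apply: eq_bigr => j _.
  transitivity (\sum_i \sum_k P b j * P c k * curvature_mx g i j x k i).
    apply: eq_bigr => i _; rewrite mxE mulr_sumr.
    by apply: eq_bigr => k _; rewrite mulrA.
  rewrite exchange_big; apply: eq_bigr => k _.
  rewrite -mulr_sumr; congr (_ * _); rewrite [RHS]mxE.
  by apply: eq_bigr => i _; rewrite curvature_mx.unlock mxE.
apply: eq_bigr => k _; rewrite trmx_entry [in RHS]mxE mulr_suml.
by apply: eq_bigr => j _; rewrite mulrAC.
Qed.

Lemma frame_scalar_curvature :
  scalar_curvature g x = \sum_a \sum_b r a b a b.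
Proof.
rewrite exchange_big.
transitivity (\tr (P *m ricci g x *m P^T)); last first.
  by apply: eq_bigr => b _; rewrite frame_ricci.
rewrite -mulmxA mxtrace_mulC -mulmxA -frame_gram_inv mxtrace_mulC.
rewrite /mxtrace /scalar_curvature exchange_big; apply: eq_bigr => j _.
rewrite [RHS]mxE; apply: eq_bigr => k _; congr (_ * _).
by rewrite -trmx_entry trmx_inv gsym.
Qed.

Lemma frame_einstein c : ricci g x = c *: g x -> forall a b,
  \sum_d r d a d b = (a == b)%:R * (scalar_curvature g x / 4).
Proof.
move=> E.
have h a b : \sum_d r d a d b = c * (a == b)%:R.
  by rewrite frame_ricci E -scalemxAr -scalemxAl Pg !mxE.
have -> : scalar_curvature g x = 4 * c.
  rewrite frame_scalar_curvature exchange_big.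
  rewrite (eq_bigr (fun=> c)) => [|a _]; last by rewrite h eqxx mulr1.
  by rewrite sumr_const card_ord mulr_natl.
by move=> a b; rewrite h; field.
Qed.

Lemma frame_congr_inj (A B : 'M[R]_4) :
  P *m A *m P^T = P *m B *m P^T -> A = B.
Proof.
move=> E; have PTu : P^T \in unitmx by rewrite unitmx_tr frame_unit.
by rewrite -[A](mulKmx frame_unit) -[P *m A](mulmxK PTu) E mulmxK // mulKmx // frame_unit.
Qed.

(** [P *m al *m P^T] holds the components of [al] on the frame. Raising indices is trivial there, so
    [sharp] merely carries these components back to coordinates. *)
Lemma frame_sharp al : sharp g x al = P^T *m (P *m al *m P^T) *m P.
Proof. by rewrite /sharp frame_gram_inv !mulmxA. Qed.

Lemma frame_skew al : two_form al <-> (P *m al *m P^T)^T = - (P *m al *m P^T).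
Proof.
rewrite !trmx_mul trmxK mulmxA /two_form; split=> [->|E].
  by rewrite mulmxN mulNmx.
by apply: frame_congr_inj; rewrite E mulmxN mulNmx.
Qed.

(** Determinants in [Pg] give [\det (g x) * \det P ^+ 2 = 1], and commutation with [J0] fixes the
    sign. A frame of the opposite orientation would exchange self-dual and anti-self-dual forms. *)
Lemma sqrt_det_frame : Num.sqrt (\det (g x)) * \det P = 1.
Proof.
have d0 := det_unitary_ge0 PJ.
have := congr1 determinant Pg; rewrite !det_mulmx det_tr det1 => E.
have dP : \det P != 0 by move: frame_unit; rewrite unitmxE unitfE.
have -> : \det (g x) = (\det P)^-1 ^+ 2.
  rewrite -[RHS]mul1r -[X in X * _]E.
  by move: dP; move: (\det (g x)) (\det P) => p q q0; field.
by rewrite sqrtr_sqr ger0_norm ?invr_ge0 // mulVf.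
Qed.

Lemma frame_hodge al : two_form al ->
  P *m hodge g x al *m P^T = hodge_dual (P *m al *m P^T).
Proof.
move=> /frame_skew sk.
have -> : hodge g x al = Num.sqrt (\det (g x)) *: hodge_dual (sharp g x al).
  apply/matrixP => k l; rewrite !mxE mulrA; congr (_ * _).
  by rewrite mulrC.
rewrite -scalemxAr -scalemxAl frame_sharp hodge_dual_congr //.
by rewrite scalerA sqrt_det_frame scale1r.
Qed.

Lemma frame_anti_self_dual al :
  anti_self_dual g x al <-> exists u, P *m al *m P^T = asd_mx u.
Proof.
split=> [[sk h]|[u E]].
  have [_ d01 d23 [d02 d13 d03 d12]] := hodge_dual_entries ((frame_skew al).1 sk).
  move: d01 d02 d03; rewrite -frame_hodge // h mulmxN mulNmx.
  move: (asd_mxP ((frame_skew al).1 sk)); move: (P *m al *m P^T) => be bP.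
  have oppE a b : (- be) a b = - be a b by rewrite mxE.
  rewrite !oppE => d01 d02 d03; eexists; apply: bP.
  - by rewrite -d01.
  - by apply: oppr_inj; rewrite d02.
  - by rewrite d03.
have sk : two_form al by apply/frame_skew; rewrite E asd_mx_tr.
split=> //; apply: frame_congr_inj.
by rewrite frame_hodge // E hodge_dual_asd mulmxN mulNmx E.
Qed.

Lemma frame_curvature_operator al c d :
  (P *m curvature_operator g x al *m P^T) c d =
  2^-1 * \sum_a \sum_b (P *m al *m P^T) a b * r a b c d.
Proof.
set be := P *m al *m P^T.
have sh i j : sharp g x al i j = \sum_a \sum_b P a i * P b j * be a b.
  rewrite frame_sharp -/be mxE exchange_big; apply: eq_bigr => b _.
  rewrite mxE mulr_suml; apply: eq_bigr => a _.
  by rewrite trmx_entry mulrAC.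
pose T i j := curvature_mx g i j x *m g x.
transitivity (2^-1 * \sum_i \sum_j sharp g x al i j * (P *m T i j *m P^T) d c).
  have -> : curvature_operator g x al =
      2^-1 *: \sum_i \sum_j sharp g x al i j *: (T i j)^T.
    apply/matrixP => k l; rewrite !mxE summxE; congr (_ * _).
    apply: eq_bigr => i _; rewrite summxE; apply: eq_bigr => j _.
    by rewrite [RHS]mxE trmx_entry curvE.
  rewrite -scalemxAr -scalemxAl mulmx_sumr mulmx_suml mxE summxE.
  congr (_ * _); apply: eq_bigr => i _.
  rewrite mulmx_sumr mulmx_suml summxE; apply: eq_bigr => j _.
  rewrite -scalemxAr -scalemxAl [LHS]mxE; congr (_ * _).
  by move: (T i j) => M; rewrite -[RHS]trmx_entry !trmx_mul trmxK mulmxA.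
congr (_ * _).
transitivity (\sum_i \sum_j \sum_a \sum_b
    be a b * (P a i * P b j * (P *m T i j *m P^T) d c)).
  apply: eq_bigr => i _; apply: eq_bigr => j _; rewrite sh mulr_suml.
  apply: eq_bigr => a _; rewrite mulr_suml; apply: eq_bigr => b _.
  by rewrite mulrAC mulrC.
under eq_bigr => i _ do rewrite exchange_big.
rewrite exchange_big; apply: eq_bigr => a _.
under eq_bigr => i _ do rewrite exchange_big.
rewrite exchange_big; apply: eq_bigr => b _.
rewrite frame_curvE mulr_sumr; apply: eq_bigr => i _.
by rewrite mulr_sumr.
Qed.

(** [asd_contraction] evaluates the curvature operator on the frame and [asd_projection] projects
    the result; only the projection leaves a factor [2^-1], the one in [weyl_mx]. *)
Lemma frame_weyl_minus al u : P *m al *m P^T = asd_mx u ->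
  P *m weyl_minus g x al *m P^T =
  asd_mx (u *m weyl_mx r (scalar_curvature g x)).
Proof.
move=> E; have kr := frame_kahler_tensor.
set C := curvature_operator g x al.
have Cd c d : (P *m C *m P^T) c d = \sum_k u 0 k * asd_coord (fun a b => r a b c d) k.
  rewrite frame_curvature_operator E asd_contraction // => a b.
  exact: kt_skew12.
have Csk : (P *m C *m P^T)^T = - (P *m C *m P^T).
  apply/matrixP => c d; rewrite trmx_entry [RHS]mxE !Cd -sumrN.
  apply: eq_bigr => k _; rewrite -mulrN; congr (_ * _).
  by elim/ord3_ind: k; rewrite !asd_coordE !(kt_skew34 kr _ _ c d); ring.
have -> : P *m weyl_minus g x al *m P^T =
    2^-1 *: (P *m C *m P^T - hodge_dual (P *m C *m P^T))
    - (scalar_curvature g x / 12) *: asd_mx u.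
  rewrite -frame_hodge; last exact/frame_skew.
  rewrite /weyl_minus /proj_asd -/C -E.
  by rewrite mulmxBr mulmxBl -!scalemxAr -!scalemxAl mulmxBr mulmxBl.
rewrite asd_projection // -scaleNr addrC -asd_mx_linear; congr asd_mx.
apply/rowP => l; rewrite mxE [X in X + _]mxE [X in _ + X]mxE [RHS]mxE.
rewrite big_ord3 !weyl_mxE.
elim/ord3_ind: l; rewrite !asd_coordE !Cd !big_ord3 !asd_coordE /=.
all: move: (scalar_curvature g x) (r _ _ _ _) => s ?; ring.
Qed.

End FrameForms.

(** * Extrema of a quadratic form and surjectivity of the Hopf map *)

Lemma mulmx_tr_ge0 (R : realDomainType) n (v : 'rV[R]_n) : 0 <= (v *m v^T) 0 0.
Proof. by rewrite mxE sumr_ge0 // => k _; rewrite trmx_entry -expr2 sqr_ge0. Qed.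

Lemma mulmx_tr_eq0 (R : realDomainType) n (v : 'rV[R]_n) :
  (v *m v^T) 0 0 = 0 -> v = 0.
Proof.
rewrite mxE => /eqP; rewrite psumr_eq0 => [/allP h|k _]; last first.
  by rewrite trmx_entry -expr2 sqr_ge0.
apply/rowP => k; have := h k (mem_index_enum _).
by rewrite trmx_entry -expr2 sqrf_eq0 mxE => /eqP.
Qed.

(** For symmetric [D] the diagonal of [D *m D] consists of the squared norms of the rows of [D]. *)
Lemma sym_sqr_eq0 (R : realDomainType) n (D : 'M[R]_n) :
  D^T = D -> D *m D = 0 -> D = 0.
Proof.
move=> DT DD; apply/row_matrixP => i; rewrite row0; apply: mulmx_tr_eq0.
transitivity ((D *m D) i i); last by rewrite DD mxE.
rewrite !mxE; apply: eq_bigr => k _; rewrite trmx_entry !mxE.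
by congr (_ * _); rewrite -trmx_entry DT.
Qed.

Lemma sqrt_psd (R : realDomainType) n (C S : 'M[R]_n) (v : 'rV[R]_n) :
  S^T = S -> S *m S = C -> 0 <= (v *m C *m v^T) 0 0.
Proof.
by move=> ST <-; have := mulmx_tr_ge0 (v *m S); rewrite trmx_mul ST !mulmxA.
Qed.

Lemma cubic_expand (R : realDomainType) n (c3 c2 c : 'M[R]_n) a b :
  c3 - a *: c2 - b *: (c2 - a *: c) = 0 ->
  c3 = (a + b) *: c2 - (a * b) *: c.
Proof.
by move=> /matrixP h; apply/matrixP => i j; have := h i j; rewrite !mxE; lra.
Qed.

(* [S = C (al C + be)] is a square root of [C], where [t (al t + be)]
   interpolates the square root on the spectrum [{0, a, b}]. *)
Lemma cubic_psd (R : rcfType) n (C : 'M[R]_n) (a b : R) (v : 'rV[R]_n) :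
  C^T = C -> 0 <= a -> 0 <= b ->
  C *m (C - a%:M) *m (C - b%:M) = 0 -> 0 <= (v *m C *m v^T) 0 0.
Proof.
move=> CT.
(* The degenerate case, where the interpolation would divide by zero: C (C - a') is symmetric with
   zero square, hence zero, so C / sqrt a' is a square root of [C]; for a' = 0, [C] itself
   vanishes. *)
have psd0 a' : 0 <= a' -> C *m (C - a'%:M) *m C = 0 -> 0 <= (v *m C *m v^T) 0 0.
  move=> a0 h; have E : C *m (C - a'%:M) = 0.
    apply: sym_sqr_eq0; last by rewrite mulmxA h mul0mx.
    rewrite trmx_mul linearB /= CT tr_scalar_mx mulmxBl mulmxBr.
    by rewrite scalar_mxC.
  move: E a0; rewrite mulmxBr mul_mx_scalar => /eqP; rewrite subr_eq0 => /eqP E.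
  rewrite le_eqVlt => /orP[/eqP a0|a0].
    by rewrite (@sym_sqr_eq0 _ _ C) // ?mulmx0 ?mul0mx ?mxE // E -a0 scale0r.
  apply: (@sqrt_psd _ _ _ ((Num.sqrt a')^-1 *: C)); first by rewrite linearZ /= CT.
  rewrite -scalemxAl -scalemxAr E !scalerA -invfM -expr2 sqr_sqrtr ?ltW //.
  by rewrite mulVf ?scale1r // gt_eqF.
move=> a0 b0 h.
have [bz|bn] := eqVneq b 0.
  by apply: psd0 a0 _; move: h; rewrite bz raddf0 subr0.
have [az|an] := eqVneq a 0.
  apply: psd0 b0 _; move: h; rewrite az raddf0 subr0 => h.
  rewrite -mulmxA -[RHS]h mulmxBl !mulmxBr !mulmxA.
  by rewrite -!mulmxA -scalar_mxC.
have a1 : 0 < a by rewrite lt_neqAle eq_sym an.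
have b1 : 0 < b by rewrite lt_neqAle eq_sym bn.
set p := Num.sqrt a; set q := Num.sqrt b.
have pp : 0 < p by rewrite sqrtr_gt0.
have qp : 0 < q by rewrite sqrtr_gt0.
have pa : a = p ^+ 2 by rewrite sqr_sqrtr.
have qb : b = q ^+ 2 by rewrite sqr_sqrtr.
(* [al] and [be] solve al t + be = 1 / sqrt t at t = a and t = b. The factor [p - q] has cancelled,
   so [a = b] is no exception. *)
pose al := - (p * q * (p + q))^-1.
pose be := (p ^+ 2 + p * q + q ^+ 2) / (p * q * (p + q)).
pose C2 := C *m C.
have C3 : C2 *m C = (a + b) *: C2 - (a * b) *: C.
  have E : C *m (C - a%:M) = C2 - a *: C by rewrite mulmxBr mul_mx_scalar.
  move: h; rewrite E mulmxBr mul_mx_scalar mulmxBl -scalemxAl -/C2.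
  exact: cubic_expand.
have C4 : C2 *m C2 = (a + b) *: (C2 *m C) - (a * b) *: C2.
  by rewrite {2}/C2 mulmxA [X in X *m C]C3 mulmxBl -!scalemxAl.
apply: (@sqrt_psd _ _ _ (al *: C2 + be *: C)).
  by rewrite linearD !linearZ /= /C2 trmx_mul CT.
rewrite mulmxDl !mulmxDr -!scalemxAl -!scalemxAr C4 C3 mulmxA -/C2 C3.
apply/matrixP => i j; rewrite !mxE; move: (C2 i j) (C i j) => c2 c.
rewrite pa qb /al /be; field.
by rewrite !gt_eqF // addr_gt0.
Qed.

Lemma eigenvector_unit (R : rcfType) n (B : 'M[R]_n) l : eigenvalue B l ->
  exists2 h : 'rV[R]_n, (h *m h^T) 0 0 = 1 & h *m B = l *: h.
Proof.
case/eigenvalueP => v vB v0; exists ((Num.sqrt ((v *m v^T) 0 0))^-1 *: v); last first.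
  by rewrite -scalemxAl vB !scalerA mulrC.
have vv : 0 < (v *m v^T) 0 0.
  rewrite lt_neqAle mulmx_tr_ge0 andbT eq_sym.
  by apply: contra_neq v0; exact: mulmx_tr_eq0.
rewrite linearZ /= -scalemxAl -scalemxAr !mxE mulrA -invfM -expr2.
rewrite sqr_sqrtr; last by rewrite mxE in vv; exact: ltW.
by rewrite mulVf // gt_eqF //; rewrite mxE in vv.
Qed.

Section SymmetricSpectrum.
Context (R : rcfType) (A B K : 'M[R]_3) (l1 l2 l3 : R).
Context (Bsym : B^T = B) (Ku : K \in unitmx) (KB : K *m B = A *m K)
  (chA : char_poly A = ('X - l1%:P) * ('X - l2%:P) * ('X - l3%:P))
  (h12 : l1 <= l2) (h23 : l2 <= l3).

(** Cayley-Hamilton for [A], carried by [K] to the symmetric [B]; [A] need not be symmetric, its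
    basis being arbitrary. The order of the roots is left free because the two bounds use different
    ones. *)
Lemma similar_cubic a b c : char_poly A = ('X - a%:P) * ('X - b%:P) * ('X - c%:P) ->
  (B - a%:M) *m (B - b%:M) *m (B - c%:M) = 0.
Proof.
move=> ch; have := Cayley_Hamilton A.
rewrite ch !rmorphM !rmorphB /= !horner_mx_X !horner_mx_C => E.
have sh l : K *m (B - l%:M) = (A - l%:M) *m K.
  by rewrite mulmxBr mulmxBl KB scalar_mxC.
rewrite -!mulmxE in E.
rewrite -[LHS](mulKmx Ku) (_ : K *m _ = 0) ?mulmx0 //.
by rewrite !mulmxA sh -(mulmxA _ K) sh mulmxA -(mulmxA _ K) sh mulmxA E mul0mx.
Qed.

(** [l3%:M - B] is annihilated by the cubic with the nonnegative roots 0, [l3 - l1] and [l3 - l2],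
    so [cubic_psd] applies; the lower bound treats [B - l1%:M] in the same way. *)
Lemma quadratic_form_le (h : 'rV_3) : (h *m h^T) 0 0 = 1 -> (h *m B *m h^T) 0 0 <= l3.
Proof.
move=> h1; have := @cubic_psd R 3 (l3%:M - B) (l3 - l1) (l3 - l2) h.
rewrite linearB /= Bsym tr_scalar_mx !subr_ge0 h23 (le_trans h12 h23).
move=> /(_ erefl isT isT) H.
have {}H : 0 <= (h *m (l3%:M - B) *m h^T) 0 0.
  apply: H.
  have e c : l3%:M - B - (l3 - c)%:M = - (B - c%:M).
    by rewrite raddfB /= opprB addrC addrA subrK opprB.
  rewrite !e -opprB !(mulNmx, mulmxN) similar_cubic ?oppr0 //.
  by rewrite chA mulrC mulrA.
move: H; rewrite mulmxBr mulmxBl mul_mx_scalar -scalemxAl mx_entryB.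
by rewrite [X in X - _]mxE h1 mulr1 subr_ge0.
Qed.

Lemma quadratic_form_ge (h : 'rV_3) : (h *m h^T) 0 0 = 1 -> l1 <= (h *m B *m h^T) 0 0.
Proof.
move=> h1; have := @cubic_psd R 3 (B - l1%:M) (l2 - l1) (l3 - l1) h.
rewrite linearB /= Bsym tr_scalar_mx !subr_ge0 h12 (le_trans h12 h23).
move=> /(_ erefl isT isT) H.
have {}H : 0 <= (h *m (B - l1%:M) *m h^T) 0 0.
  apply: H.
  have e c : B - l1%:M - (c - l1)%:M = B - c%:M.
    by rewrite raddfB /= opprB addrA subrK.
  by rewrite !e similar_cubic.
move: H; rewrite mulmxBr mulmxBl mul_mx_scalar -scalemxAl mx_entryB.
by rewrite [X in _ - X]mxE h1 mulr1 subr_ge0.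
Qed.

Lemma quadratic_form_attained l : root (char_poly A) l ->
  exists2 h : 'rV_3, (h *m h^T) 0 0 = 1 & (h *m B *m h^T) 0 0 = l.
Proof.
rewrite -eigenvalue_root_char => /eigenvalueP[w wA w0].
have : eigenvalue B l.
  apply/eigenvalueP; exists (w *m K).
    by rewrite -mulmxA KB mulmxA wA scalemxAl.
  by apply: contra_neq w0 => E; rewrite -[w](mulmxK Ku) E mul0mx.
case/eigenvector_unit => h h1 hB; exists h => //.
by rewrite hB -scalemxAl mxE h1 mulr1.
Qed.

End SymmetricSpectrum.

Lemma row4E (R : Type) (a b c d : R) :
  ((\row_k tnth [tuple a; b; c; d] k) 0 o0 = a) *
  ((\row_k tnth [tuple a; b; c; d] k) 0 o1 = b) *
  ((\row_k tnth [tuple a; b; c; d] k) 0 o2 = c) *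
  ((\row_k tnth [tuple a; b; c; d] k) 0 o3 = d).
Proof. by rewrite !mxE. Qed.

Lemma hopf_norm (R : realType) (y : 'rV[R]_4) :
  (hopf y *m (hopf y)^T) 0 0 = ((y *m y^T) 0 0) ^+ 2.
Proof.
rewrite mxE big_ord3 !trmx_entry !hopfE [in RHS]mxE big_ord4 !trmx_entry.
by ring.
Qed.

(** The circle fibre leaves room to ask y_1 = 0 and y_0 > 0. Then |y| = 1 forces y_0^2 = (1 + h_0) /
    2, and h_1, h_2 determine y_3, y_2. The point h_0 = -1, where this divides by zero, is the image
    of (0, 0, 1, 0). *)
Lemma hopf_surjective (R : realType) (h : 'rV[R]_3) : (h *m h^T) 0 0 = 1 ->
  exists2 y : 'rV[R]_4, (y *m y^T) 0 0 = 1 & hopf y = h.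
Proof.
rewrite mxE big_ord3 !trmx_entry => h1.
have [hm|hm] := eqVneq (h 0 q0) (-1).
  have [z1 z2] : h 0 q1 = 0 /\ h 0 q2 = 0.
    have : h 0 q1 ^+ 2 + h 0 q2 ^+ 2 == 0 by apply/eqP; move: h1; rewrite hm; lra.
    by rewrite paddr_eq0 ?sqr_ge0 // !sqrf_eq0 => /andP[/eqP-> /eqP->].
  exists (\row_k tnth [tuple 0; 0; 1; 0] k).
    by rewrite mxE big_ord4 !trmx_entry !row4E; ring.
  apply/rowP; elim/ord3_ind; rewrite !hopfE !row4E ?hm ?z1 ?z2; ring.
have hp : 0 < (1 + h 0 q0) / 2.
  have hm1 : -1 <= h 0 q0 by nra.
  have : -1 < h 0 q0 by rewrite lt_neqAle eq_sym hm.
  by lra.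
set t := Num.sqrt ((1 + h 0 q0) / 2).
have t0 : 0 < t by rewrite sqrtr_gt0.
have t2 : h 0 q0 = 2 * t ^+ 2 - 1 by rewrite sqr_sqrtr ?ltW //; field.
have h12 : h 0 q1 ^+ 2 + h 0 q2 ^+ 2 = 4 * t ^+ 2 - 4 * t ^+ 4.
  by move: h1; rewrite t2 => h1; apply: (addrI ((2 * t ^+ 2 - 1) ^+ 2)); move: h1; lra.
exists (\row_k tnth [tuple t; 0; h 0 q2 / (2 * t); - h 0 q1 / (2 * t)] k).
  rewrite mxE big_ord4 !trmx_entry !row4E.
  rewrite [LHS](_ : _ = t ^+ 2 + (h 0 q1 ^+ 2 + h 0 q2 ^+ 2) / (4 * t ^+ 2)).
    rewrite h12; field; exact: lt0r_neq0.
  field; exact: lt0r_neq0.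
apply/rowP; elim/ord3_ind; rewrite !hopfE !row4E.
- rewrite [LHS](_ : _ = t ^+ 2 - (h 0 q1 ^+ 2 + h 0 q2 ^+ 2) / (4 * t ^+ 2)).
    rewrite h12 t2; field; exact: lt0r_neq0.
  field; exact: lt0r_neq0.
- by field; rewrite gt_eqF.
- by field; rewrite gt_eqF.
Qed.

(** * Fourth moments of the unit sphere *)

HB.lock Definition segment_integral (R : realType) (b : R) (f : R -> R) : R :=
  Rintegral (@lebesgue_measure R) `[0, b]%classic f.

Section SegmentIntegral.
Context (R : realType) (b : R) (b0 : 0 < b).

Lemma segment_integrable (f : R -> R) : continuous f ->
  (@lebesgue_measure R).-integrable `[0, b]%classic (EFin \o f).
Proof.
move=> cf; apply: continuous_compact_integrable; first exact: segment_compact.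
exact: continuous_subspaceT.
Qed.

Lemma segment_integral_sum (I : Type) (s : seq I) (c : I -> R) (f : I -> R -> R) :
  (forall i, continuous (f i)) ->
  segment_integral b (fun t => \sum_(i <- s) c i * f i t) =
  \sum_(i <- s) c i * segment_integral b (f i).
Proof.
move=> cf; rewrite unlock.
have mD : measurable (`[0, b]%classic : set R) by exact: measurable_itv.
have cs r : continuous (fun t => \sum_(i <- r) c i * f i t).
  elim: r => [|i r IH] x.
    by under eq_fun do rewrite big_nil; exact: cvg_cst.
  under eq_fun do rewrite big_cons.
  by apply: cvgD; [apply: cvgM; [exact: cvg_cst|exact: cf]|exact: IH].
elim: s => [|i s IH].
  rewrite big_nil; under eq_Rintegral do rewrite big_nil.
  by rewrite Rintegral_cst // mul0r.
rewrite [RHS]big_cons (_ : (fun t => _) =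
  (fun t => c i * f i t + \sum_(i <- s) c i * f i t)); last first.
  by apply/funext => t; rewrite big_cons.
rewrite RintegralD //.
- by rewrite RintegralZl ?IH //; exact: segment_integrable.
- apply: segment_integrable => x.
  by apply: cvgM; [exact: cvg_cst|exact: cf].
- exact: segment_integrable.
Qed.

Lemma segment_integral_FTC (f F : R -> R) : continuous f ->
  (forall t : R, is_derive t 1 F (f t)) -> segment_integral b f = F b - F 0.
Proof.
move=> cf dF; rewrite unlock.
have cF : continuous F.
  move=> x; apply/differentiable_continuous/derivable1_diffP.
  by have [] := dF x.
rewrite /Rintegral (@continuous_FTC2 _ f F) //.
- exact: continuous_subspaceT.
- split; first by move=> x _; have [] := dF x.
  + exact: cvg_at_right_filter (cF 0).
  + exact: cvg_at_left_filter (cF b).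
- by move=> x _; rewrite derive1E; have [_ ->] := dF x.
Qed.

Definition trig_moment m n := segment_integral b (fun t => cos t ^+ m * sin t ^+ n).

Lemma continuous_trig m n : continuous (fun t : R => cos t ^+ m * sin t ^+ n).
Proof.
move=> x; apply: cvgM.
  by apply: (@continuous_comp _ _ _ cos (fun y => y ^+ m)); [exact: continuous_cos|exact: exprn_continuous].
by apply: (@continuous_comp _ _ _ sin (fun y => y ^+ n)); [exact: continuous_sin|exact: exprn_continuous].
Qed.

(** The truncated predecessors are harmless: at exponent 0 the coefficient [m%:R] or [n%:R]
    vanishes. *)
Lemma is_derive_trig m n (t : R) : is_derive t 1 (fun t => cos t ^+ m * sin t ^+ n)
  (n%:R * (cos t ^+ m.+1 * sin t ^+ n.-1) - m%:R * (cos t ^+ m.-1 * sin t ^+ n.+1)).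
Proof.
have dc : is_derive t 1 (fun t => cos t ^+ m) (m%:R * cos t ^+ m.-1 * - sin t).
  by have := is_deriveX m (is_derive_cos t); rewrite exprfctE.
have ds : is_derive t 1 (fun t => sin t ^+ n) (n%:R * sin t ^+ n.-1 * cos t).
  by have := is_deriveX n (is_derive_sin t); rewrite exprfctE.
have := is_derive_mul dc ds; congr (is_derive _ _ _ _).
by rewrite !exprS; ring.
Qed.

Lemma trig_moment_split m n :
  trig_moment m n = trig_moment m.+2 n + trig_moment m n.+2.
Proof.
pose f (i : bool) t : R := if i then cos t ^+ m.+2 * sin t ^+ n else cos t ^+ m * sin t ^+ n.+2.
have := @segment_integral_sum bool [:: true; false] (fun=> 1) f.
rewrite !big_cons !big_nil !mul1r addr0 => <-; last by case; exact: continuous_trig.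
congr segment_integral; apply/funext => t; rewrite !big_cons !big_nil !mul1r addr0 /=.
by rewrite !exprS -[LHS]mul1r -(cos2Dsin2 t); ring.
Qed.

(** The integral of the derivative in [is_derive_trig]. The boundary term [0 ^+ n] at 0 equals 1
    when [n = 0]. *)
Lemma trig_moment_derivative m n :
  n%:R * trig_moment m.+1 n.-1 - m%:R * trig_moment m.-1 n.+1 =
  cos b ^+ m * sin b ^+ n - (0 ^+ n : R).
Proof.
pose f (i : bool) t : R := if i then cos t ^+ m.+1 * sin t ^+ n.-1 else cos t ^+ m.-1 * sin t ^+ n.+1.
pose c i : R := if i then n%:R else - m%:R.
have := @segment_integral_sum bool [:: true; false] c f.
rewrite !big_cons !big_nil addr0 mulNr => <-; last by case; exact: continuous_trig.
have E t : \sum_(i <- [:: true; false]) c i * f i t =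
    n%:R * (cos t ^+ m.+1 * sin t ^+ n.-1) - m%:R * (cos t ^+ m.-1 * sin t ^+ n.+1).
  by rewrite !big_cons !big_nil addr0 mulNr.
under [X in segment_integral b X]eq_fun do rewrite E.
have cf : continuous (fun t : R => n%:R * (cos t ^+ m.+1 * sin t ^+ n.-1)
    - m%:R * (cos t ^+ m.-1 * sin t ^+ n.+1)).
  by move=> x; apply: cvgB; apply: cvgM; first [exact: cvg_cst|exact: continuous_trig].
by rewrite (segment_integral_FTC cf (is_derive_trig m n)) cos0 sin0 expr1n mul1r.
Qed.

Context (sb : sin b = 0).

Lemma trig_moment00 : trig_moment 0 0 = b.
Proof.
have dF (t : R) : is_derive t 1 id (cos t ^+ 0 * sin t ^+ 0).
  by rewrite !expr0 mulr1; exact: is_derive_id.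
by rewrite /trig_moment (segment_integral_FTC (@continuous_trig 0 0) dF) subr0.
Qed.

Lemma trig_moment_cos1 n : trig_moment 1 n = 0.
Proof.
have := trig_moment_derivative 0 n.+1.
rewrite mul0r subr0 sb !exprS !mul0r mulr0 subr0 => /eqP.
by rewrite mulf_eq0 pnatr_eq0 /= => /eqP.
Qed.

Lemma trig_moment_sin1 m : trig_moment m 1 = (1 - cos b ^+ m.+1) / m.+1%:R.
Proof.
have := trig_moment_derivative m.+1 0.
rewrite mul0r sub0r expr0 mulr1 /= => /eqP; rewrite eqr_oppLR opprB => /eqP <-.
by rewrite mulrC mulKf // pnatr_eq0.
Qed.

Lemma trig_moment_ratio m n :
  n.+1%:R * trig_moment m.+2 n = m.+1%:R * trig_moment m n.+2.
Proof.
apply/eqP; rewrite -subr_eq0; apply/eqP.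
have := trig_moment_derivative m.+1 n.+1.
by rewrite sb !exprS !mul0r mulr0 subrr.
Qed.

(** Wallis reduction: [trig_moment_ratio], an integration by parts, and [trig_moment_split], from
    cos^2 + sin^2 = 1, are two linear equations for the two moments with an exponent raised by 2. *)
Lemma trig_moment_cosSS m n : trig_moment m.+2 n =
  m.+1%:R / (m + n).+2%:R * trig_moment m n.
Proof.
have := trig_moment_ratio m n; rewrite (trig_moment_split m n).
move: (trig_moment _ _) (trig_moment _ _) => u v.
have N0 : (m + n).+2%:R != 0 :> R by rewrite pnatr_eq0.
move: N0; rewrite -!natr1 natrD; move: (m%:R) (n%:R) => p q N0 E.
by apply: (mulIf N0); rewrite mulrAC divfK //; move: E; lra.
Qed.

Lemma trig_moment_sinSS m n : trig_moment m n.+2 =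
  n.+1%:R / (m + n).+2%:R * trig_moment m n.
Proof.
have := trig_moment_ratio m n; rewrite (trig_moment_split m n).
move: (trig_moment _ _) (trig_moment _ _) => u v.
have N0 : (m + n).+2%:R != 0 :> R by rewrite pnatr_eq0.
move: N0; rewrite -!natr1 natrD; move: (m%:R) (n%:R) => p q N0 E.
by apply: (mulIf N0); rewrite mulrAC divfK //; move: E; lra.
Qed.

End SegmentIntegral.

(** The integral is iterated, so linearity pulls the other variables out one integration at a time,
    the innermost first. *)
Lemma sphere_integral_separable (R : realType) (I : finType) (K : I -> R)
    (A B C : I -> R -> R) :
  (forall i, continuous (A i)) -> (forall i, continuous (B i)) ->
  (forall i, continuous (C i)) ->
  segment_integral pi (fun psi => segment_integral pi (fun theta =>
    segment_integral (2 * pi) (fun phi =>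
      \sum_i K i * (A i psi * B i theta * C i phi)))) =
  \sum_i K i * (segment_integral pi (A i) * segment_integral pi (B i)
                * segment_integral (2 * pi) (C i)).
Proof.
move=> cA cB cC.
transitivity (segment_integral pi (fun psi => segment_integral pi (fun theta =>
    \sum_i (K i * segment_integral (2 * pi) (C i) * A i psi) * B i theta))).
  congr segment_integral; apply/funext => psi; congr segment_integral; apply/funext => theta.
  rewrite (_ : (fun phi => _) = fun phi => \sum_i (K i * A i psi * B i theta) * C i phi).
    by rewrite segment_integral_sum //; apply: eq_bigr => i _; ring.
  by apply/funext => phi; apply: eq_bigr => i _; ring.
transitivity (segment_integral pi (fun psi =>
    \sum_i (K i * segment_integral (2 * pi) (C i) * segment_integral pi (B i)) * A i psi)).
  congr segment_integral; apply/funext => psi.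
  by rewrite segment_integral_sum //; apply: eq_bigr => i _; ring.
by rewrite segment_integral_sum //; apply: eq_bigr => i _; ring.
Qed.

Definition sphere_coord (R : realType) (psi theta phi : R) (a : 'I_4) : R :=
  tnth [tuple cos psi; sin psi * cos theta; sin psi * sin theta * cos phi;
              sin psi * sin theta * sin phi] a.

(** With each coordinate a monomial with exponents 0 or 1, the exponents in a product of four
    coordinates are counts of indices, as in [count4]. *)
Lemma sphere_coordE (R : realType) (psi theta phi : R) a :
  sphere_coord psi theta phi a =
  cos psi ^+ (a == 0%N :> nat) * sin psi ^+ (0 < a)%N *
  (cos theta ^+ (a == 1%N :> nat) * sin theta ^+ (1 < a)%N) *
  (cos phi ^+ (a == 2%N :> nat) * sin phi ^+ (2 < a)%N).
Proof.
elim/ord4_ind: a; rewrite /sphere_coord /tnth /=;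
  by rewrite ?expr0 ?expr1 ?mulr1 ?mul1r ?mulrA.
Qed.

Definition count4 (P : nat -> bool) (a b c d : 'I_4) : nat := P a + P b + P c + P d.

(** The shifts [.+2] and [.+1] absorb the density sin^2 psi sin theta. *)
Lemma sphere_monomial (R : realType) (psi theta phi : R) a b c d :
  let e k := count4 (eq_op k) a b c d in let f k := count4 (ltn k) a b c d in
  sphere_coord psi theta phi a * sphere_coord psi theta phi b
  * sphere_coord psi theta phi c * sphere_coord psi theta phi d
  * (sin psi ^+ 2 * sin theta) =
  cos psi ^+ e 0%N * sin psi ^+ (f 0%N).+2 *
  (cos theta ^+ e 1%N * sin theta ^+ (f 1%N).+1) *
  (cos phi ^+ e 2%N * sin phi ^+ f 2%N).
Proof.
move=> e f; rewrite !sphere_coordE /e /f /count4 !(eq_sym _ (nat_of_ord _)).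
rewrite !exprS !exprD.
do 3!move: (_ ^+ (a == _ :> nat)) (_ ^+ (b == _ :> nat)) (_ ^+ (c == _ :> nat))
  (_ ^+ (d == _ :> nat)) => ? ? ? ?.
do 3!move: (_ ^+ (_ < a)%N) (_ ^+ (_ < b)%N) (_ ^+ (_ < c)%N)
  (_ ^+ (_ < d)%N) => ? ? ? ?.
by ring.
Qed.

Ltac eval_count :=
  repeat match goal with |- context [count4 ?P ?a ?b ?c ?d] =>
    let v := eval vm_compute in (count4 P a b c d) in
    change (count4 P a b c d) with v end.

(* Stated for abstract moments so that the 256 index quadruples are settled by
   computation in a field. *)
Lemma wallis_moment (R : realFieldType) (p : R) (M1 M2 : nat -> nat -> R) :
  (forall m n, M1 m.+2 n = m.+1%:R / (m + n).+2%:R * M1 m n) ->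
  (forall m n, M1 m n.+2 = n.+1%:R / (m + n).+2%:R * M1 m n) ->
  (forall m n, M2 m.+2 n = m.+1%:R / (m + n).+2%:R * M2 m n) ->
  (forall m n, M2 m n.+2 = n.+1%:R / (m + n).+2%:R * M2 m n) ->
  (forall n, M1 1%N n = 0) -> (forall n, M2 1%N n = 0) ->
  M1 0%N 1%N = 2 -> M2 0%N 1%N = 0 -> M1 0%N 0%N = p -> M2 0%N 0%N = 2 * p ->
  forall a b c d : 'I_4,
  let e k := count4 (eq_op k) a b c d in let f k := count4 (ltn k) a b c d in
  M1 (e 0%N) (f 0%N).+2 * M1 (e 1%N) (f 1%N).+1 * M2 (e 2%N) (f 2%N) =
  p ^+ 2 / 12 * ((a == b)%:R * (c == d)%:R + (a == c)%:R * (b == d)%:R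
                  + (a == d)%:R * (b == c)%:R).
Proof.
move=> C1 S1 C2 S2 Z1 Z2 O1 O2 B1 B2 a b c d e f; rewrite /e /f {e f}.
elim/ord4_ind: a; elim/ord4_ind: b; elim/ord4_ind: c; elim/ord4_ind: d;
  eval_count; rewrite /=;
  rewrite ?(C1, C2) ?(Z1, Z2) ?(S1, S2) ?(O1, O2, B1, B2) ?mulr0 ?mul0r ?mulr0 ?addr0 ?mulr0 //.
all: by field.
Qed.

(** The constant is the volume 2 pi^2 of S^3 times 1/24, where 24 = 4 (4 + 2) normalises fourth
    moments on the unit sphere of R^4. *)
Lemma sphere_moment (R : realType) (a b c d : 'I_4) :
  let e k := count4 (eq_op k) a b c d in let f k := count4 (ltn k) a b c d in
  trig_moment (pi : R) (e 0%N) (f 0%N).+2 * trig_moment pi (e 1%N) (f 1%N).+1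
    * trig_moment (2 * pi) (e 2%N) (f 2%N) =
  pi ^+ 2 / 12 * ((a == b)%:R * (c == d)%:R + (a == c)%:R * (b == d)%:R
                  + (a == d)%:R * (b == c)%:R).
Proof.
have pi0 : 0 < pi :> R by exact: pi_gt0.
have pi20 : 0 < 2 * pi :> R by rewrite mulr_gt0.
have s2 : sin (2 * pi) = 0 :> R by rewrite mulr_natl sin2pi.
have c2 : cos (2 * pi) = 1 :> R by rewrite mulr_natl cos2pi.
have s1 := sinpi R.
apply: wallis_moment.
- exact: trig_moment_cosSS.
- exact: trig_moment_sinSS.
- exact: trig_moment_cosSS.
- exact: trig_moment_sinSS.
- exact: trig_moment_cos1.
- exact: trig_moment_cos1.
- by rewrite trig_moment_sin1 // cospi; field.
- by rewrite trig_moment_sin1 // c2; field.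
- exact: trig_moment00.
- exact: trig_moment00.
Qed.

Lemma sphere_volume (R : realType) :
  segment_integral pi (fun psi => segment_integral pi (fun theta =>
    segment_integral (2 * pi) (fun phi => 1 * (sin psi ^+ 2 * sin theta))))
  = 2 * pi ^+ 2 :> R.
Proof.
have pi0 : 0 < pi :> R by exact: pi_gt0.
have pi20 : 0 < 2 * pi :> R by rewrite mulr_gt0.
pose A (i : 'I_1) (t : R) := cos t ^+ 0 * sin t ^+ 2.
pose B (i : 'I_1) (t : R) := cos t ^+ 0 * sin t ^+ 1.
pose C (i : 'I_1) (t : R) := cos t ^+ 0 * sin t ^+ 0.
have := @sphere_integral_separable R _ (fun=> 1) A B C
  (fun=> @continuous_trig R 0 2) (fun=> @continuous_trig R 0 1)
  (fun=> @continuous_trig R 0 0).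
rewrite big_ord1 mul1r -!/(trig_moment _ _ _) => E.
transitivity (trig_moment (pi : R) 0 2 * trig_moment pi 0 1 * trig_moment (2 * pi) 0 0).
  rewrite -E; congr segment_integral; apply/funext => psi.
  congr segment_integral; apply/funext => theta; congr segment_integral.
  apply/funext => phi.
  by rewrite big_ord1 /A /B /C !expr0 !mul1r mulr1 expr1.
rewrite trig_moment_sinSS ?sinpi // !trig_moment00 // trig_moment_sin1 // cospi.
by field.
Qed.

Lemma big_pairE (V : nmodType) (I J : finType) (F : I * J -> V) :
  \sum_q F q = \sum_i \sum_j F (i, j).
Proof. by rewrite pair_bigA; apply: eq_bigr => -[]. Qed.

Lemma sum_delta (R : pzRingType) n (F : 'I_n -> R) a :
  \sum_b F b * (a == b)%:R = F a.
Proof.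
rewrite (bigD1 a) //= eqxx mulr1 big1 ?addr0 // => b.
by rewrite eq_sym => /negPf ->; rewrite mulr0.
Qed.

Lemma quartic_contraction (R : comPzRingType) (K : 'I_4 -> 'I_4 -> 'I_4 -> 'I_4 -> R) :
  \sum_a \sum_b \sum_c \sum_d K a b c d * ((a == b)%:R * (c == d)%:R
    + (a == c)%:R * (b == d)%:R + (a == d)%:R * (b == c)%:R) =
  \sum_a \sum_b (K a a b b + K a b a b + K a b b a).
Proof.
apply: eq_bigr => a _.
transitivity (\sum_b \sum_c \sum_d K a b c d * ((a == b)%:R * (c == d)%:R)
  + \sum_b \sum_c \sum_d K a b c d * ((a == c)%:R * (b == d)%:R)
  + \sum_b \sum_c \sum_d K a b c d * ((a == d)%:R * (b == c)%:R)).
  rewrite -!big_split; apply: eq_bigr => b _; rewrite -!big_split.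
  apply: eq_bigr => c _; rewrite -!big_split; apply: eq_bigr => d _.
  by rewrite /= !mulrDr.
rewrite !big_split; congr (_ + _ + _).
- transitivity (\sum_b (\sum_c K a b c c) * (a == b)%:R); last exact: sum_delta.
  apply: eq_bigr => b _; rewrite mulr_suml; apply: eq_bigr => c _.
  rewrite -[K a b c c](sum_delta (K a b c)) mulr_suml.
  by apply: eq_bigr => d _; ring.
- apply: eq_bigr => b _.
  transitivity (\sum_c K a b c b * (a == c)%:R); last exact: (sum_delta (fun c => K a b c b)).
  apply: eq_bigr => c _; rewrite -[K a b c b](sum_delta (K a b c)) mulr_suml.
  by apply: eq_bigr => d _; ring.
- apply: eq_bigr => b _.
  transitivity (\sum_c K a b c a * (b == c)%:R); last exact: (sum_delta (fun c => K a b c a)).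
  apply: eq_bigr => c _; rewrite -[K a b c a](sum_delta (K a b c)) mulr_suml.
  by apply: eq_bigr => d _; ring.
Qed.

Lemma sphere_quartic (R : realType) (K : 'I_4 -> 'I_4 -> 'I_4 -> 'I_4 -> R) :
  segment_integral pi (fun psi => segment_integral pi (fun theta =>
    segment_integral (2 * pi) (fun phi =>
      let t := sphere_coord psi theta phi in
      (\sum_a t a * \sum_b t b * \sum_c t c * \sum_d t d * K a b c d)
      * (sin psi ^+ 2 * sin theta)))) =
  pi ^+ 2 / 12 * \sum_a \sum_b (K a a b b + K a b a b + K a b b a).
Proof.
(* Quadruples of indices form one finite type, because [sphere_integral_separable] handles a single
   sum. *)
pose I := ('I_4 * ('I_4 * ('I_4 * 'I_4)))%type.
pose e k (q : I) := count4 (eq_op k) q.1 q.2.1 q.2.2.1 q.2.2.2.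
pose f k (q : I) := count4 (ltn k) q.1 q.2.1 q.2.2.1 q.2.2.2.
pose A (q : I) (t : R) := cos t ^+ e 0%N q * sin t ^+ (f 0%N q).+2.
pose B (q : I) (t : R) := cos t ^+ e 1%N q * sin t ^+ (f 1%N q).+1.
pose C (q : I) (t : R) := cos t ^+ e 2%N q * sin t ^+ f 2%N q.
pose K' (q : I) := K q.1 q.2.1 q.2.2.1 q.2.2.2.
have sum4 (F : I -> R) : \sum_q F q = \sum_a \sum_b \sum_c \sum_d F (a, (b, (c, d))).
  rewrite big_pairE; apply: eq_bigr => a _; rewrite big_pairE.
  by apply: eq_bigr => b _; rewrite big_pairE.
have := @sphere_integral_separable R I K' A B C
  (fun=> @continuous_trig R _ _) (fun=> @continuous_trig R _ _)
  (fun=> @continuous_trig R _ _).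
have -> : \sum_i K' i * (segment_integral pi (A i) * segment_integral pi (B i)
    * segment_integral (2 * pi) (C i)) =
    pi ^+ 2 / 12 * \sum_a \sum_b (K a a b b + K a b a b + K a b b a).
  rewrite sum4 -quartic_contraction mulr_sumr; apply: eq_bigr => a _.
  rewrite mulr_sumr; apply: eq_bigr => b _; rewrite mulr_sumr; apply: eq_bigr => c _.
  rewrite mulr_sumr; apply: eq_bigr => d _; by rewrite [RHS]mulrCA -sphere_moment.
move=> <-; congr segment_integral; apply/funext => psi.
congr segment_integral; apply/funext => theta; congr segment_integral.
apply/funext => phi; rewrite /= sum4 mulr_suml; apply: eq_bigr => a _.
rewrite mulr_sumr mulr_suml; apply: eq_bigr => b _.
rewrite mulr_sumr mulr_sumr mulr_suml; apply: eq_bigr => c _.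
rewrite mulr_sumr mulr_sumr mulr_sumr mulr_suml; apply: eq_bigr => d _.
rewrite /K' /A /B /C /e /f /= -(sphere_monomial psi theta phi a b c d).
by move: (sphere_coord _ _ _ _) (sphere_coord _ _ _ _) (sphere_coord _ _ _ _) (K _ _ _ _) => *; ring.
Qed.

(** * Average and extrema of the holomorphic sectional curvature *)

Lemma linear_functional_J0 (R : realType) (f : 'rV[R]_4 -> R) :
  linear_functional f -> linear_functional (fun X => f (X *m J0 R)).
Proof. by move=> lf c X Y; rewrite mulmxDl -scalemxAl lf. Qed.

Lemma linear_functional_sum (R : comNzRingType) n (f : 'I_n -> 'rV[R]_4 -> R) :
  (forall i, linear_functional (f i)) ->
  linear_functional (fun X => \sum_i f i X).
Proof.
move=> lf c X Y; rewrite mulr_sumr -big_split; apply: eq_bigr => i _.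
exact: lf.
Qed.

(** Since [O^T *m O = 1%:M], the trace of a bilinear form is the same in both frames. This allows an
    average over a frame not adapted to [J0]. *)
Lemma trace_frame (R : realType) (f : 'rV[R]_4 -> 'rV[R]_4 -> R) (O P : 'M[R]_4) :
  (forall Y, linear_functional (f^~ Y)) -> (forall X, linear_functional (f X)) ->
  O *m O^T = 1%:M ->
  \sum_a f (row a (O *m P)) (row a (O *m P)) = \sum_i f (row i P) (row i P).
Proof.
move=> l1 l2 OO; have OO' : O^T *m O = 1%:M by exact: mulmx1C.
transitivity (\sum_i \sum_j (O^T *m O) i j * f (row i P) (row j P)).
  transitivity (\sum_a \sum_i \sum_j O a i * O a j * f (row i P) (row j P)).
    apply: eq_bigr => a _; rewrite row_mul (linear_functional_frame (l1 _)).
    apply: eq_bigr => i _; rewrite (linear_functional_frame (l2 _)) mulr_sumr.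
    by apply: eq_bigr => j _; rewrite !mxE mulrA.
  rewrite exchange_big; apply: eq_bigr => i _; rewrite exchange_big.
  apply: eq_bigr => j _; rewrite mxE mulr_suml; apply: eq_bigr => a _.
  by rewrite trmx_entry.
apply: eq_bigr => i _; rewrite OO' (bigD1 i) //= big1 ?addr0 => [|j ij].
  by rewrite mxE eqxx mul1r.
by rewrite mxE eq_sym (negPf ij) mul0r.
Qed.

Section Average.
Context (R : realType) (g : 'rV[R]_4 -> 'M[R]_4) (x : 'rV[R]_4) (P : 'M[R]_4).
Context (kc : kahler_curvature (curvature g x)) (gsym : (g x)^T = g x)
  (gunit : g x \in unitmx)
  (Pg : P *m g x *m P^T = 1%:M) (PJ : P *m J0 R = J0 R *m P).
Let A := curvature g x.

(** Each pairing is a double trace, in [a] and in [b]. [trace_frame] replaces [O *m P] by [P] in one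
    index at a time, after which [kt_average] applies. *)
Lemma hol_contraction (O : 'M[R]_4) : O *m O^T = 1%:M ->
  let K a b c d := A (row a (O *m P)) (row b (O *m P) *m J0 R)
                     (row c (O *m P)) (row d (O *m P) *m J0 R) in
  \sum_a \sum_b (K a a b b + K a b a b + K a b b a) = 4 * scalar_curvature g x.
Proof.
move=> OO K.
have [l1 l2 l3 l4 _ _ _ _] := kc.
have l2J X Z W : linear_functional (fun Y => A X (Y *m J0 R) Z W).
  exact: (linear_functional_J0 (l2 X Z W)).
have l4J X Y Z : linear_functional (fun W => A X Y Z (W *m J0 R)).
  exact: (linear_functional_J0 (l4 X Y Z)).
pose e a := row a (O *m P); pose p a := row a P.
have T1 : \sum_a \sum_b K a a b b =
    \sum_a \sum_b A (p a) (p a *m J0 R) (p b) (p b *m J0 R).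
  transitivity (\sum_a \sum_b A (e a) (e a *m J0 R) (p b) (p b *m J0 R)).
    apply: eq_bigr => a _.
    by apply: (@trace_frame R (fun X Y => A (e a) (e a *m J0 R) X (Y *m J0 R)) O P) => //.
  by apply: (@trace_frame R (fun X Y => \sum_b A X (Y *m J0 R) (p b) (p b *m J0 R)) O P) => //
    ?; exact: linear_functional_sum.
have T2 : \sum_a \sum_b K a b a b =
    \sum_a \sum_b A (p a) (p b *m J0 R) (p a) (p b *m J0 R).
  transitivity (\sum_a \sum_b A (e a) (p b *m J0 R) (e a) (p b *m J0 R)).
    apply: eq_bigr => a _.
    by apply: (@trace_frame R (fun X Y => A (e a) (X *m J0 R) (e a) (Y *m J0 R)) O P) => //.
  by apply: (@trace_frame R (fun X Y => \sum_b A X (p b *m J0 R) Y (p b *m J0 R)) O P) => //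
    ?; exact: linear_functional_sum.
have T3 : \sum_a \sum_b K a b b a =
    \sum_a \sum_b A (p a) (p b *m J0 R) (p b) (p a *m J0 R).
  transitivity (\sum_a \sum_b A (e a) (p b *m J0 R) (p b) (e a *m J0 R)).
    apply: eq_bigr => a _.
    by apply: (@trace_frame R (fun X Y => A (e a) (X *m J0 R) Y (e a *m J0 R)) O P) => //.
  by apply: (@trace_frame R (fun X Y => \sum_b A X (p b *m J0 R) (p b) (Y *m J0 R)) O P) => //
    ?; exact: linear_functional_sum.
have kr := frame_kahler_tensor kc PJ.
rewrite -(kt_average kr (frame_scalar_curvature gsym gunit Pg)).
have q a b c d : A (p a) (p b *m J0 R) (p c) (p d *m J0 R) =
    J_sign R b * J_sign R d * frame_curv g x P a (J_index b) c (J_index d).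
  rewrite /A /p !(row_frame_J0 PJ) (linear_functionalZ (l2 _ _ _)).
  by rewrite (linear_functionalZ (l4 _ _ _)) mulrA.
have S3 (F G H : 'I_4 -> 'I_4 -> R) : \sum_a \sum_b (F a b + G a b + H a b) =
    \sum_a \sum_b F a b + \sum_a \sum_b G a b + \sum_a \sum_b H a b.
  by rewrite -!big_split; apply: eq_bigr => a _; rewrite -!big_split.
rewrite !S3 T1 T2 T3; congr (_ + _ + _);
  by apply: eq_bigr => a _; apply: eq_bigr => b _; rewrite q.
Qed.

Lemma sphere_integralE (e : 'I_4 -> 'rV[R]_4) f : sphere_integral e f =
  segment_integral pi (fun psi => segment_integral pi (fun theta =>
    segment_integral (2 * pi) (fun phi =>
      f (sphere_point e psi theta phi) * (sin psi ^+ 2 * sin theta)))).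
Proof. by rewrite segment_integral.unlock. Qed.

Lemma hol_curv_average_scalar (e : 'I_4 -> 'rV[R]_4) : orthonormal_frame g x e ->
  hol_curv_average g x e = scalar_curvature g x / 6.
Proof.
move=> one.
pose E : 'M[R]_4 := \matrix_a e a.
have Pu := frame_unit Pg.
(* The change from the unitary frame to [e]: orthogonal because both are orthonormal, but not
   assumed to commute with [J0]. *)
pose O := E *m invmx P.
have EO : E = O *m P by rewrite mulmxKV.
have eE a : e a = row a E by rewrite rowK.
move: E O EO eE => E O EO eE.
have OO : O *m O^T = 1%:M.
  transitivity (E *m g x *m E^T).
    rewrite EO trmx_mul !mulmxA -(mulmxA O P) -(mulmxA O (P *m g x)) Pg.
    by rewrite mulmx1.
  by apply/matrixP => a b; rewrite gram_row -!eE [RHS]mxE; exact: one.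
pose K a b c d := A (row a (O *m P)) (row b (O *m P) *m J0 R)
                    (row c (O *m P)) (row d (O *m P) *m J0 R).
have H psi theta phi : hol_curv g x (sphere_point e psi theta phi) =
    let t := sphere_coord psi theta phi in
    \sum_a t a * \sum_b t b * \sum_c t c * \sum_d t d * K a b c d.
  have -> : sphere_point e psi theta phi = (\row_a sphere_coord psi theta phi a) *m E.
    rewrite mulmx_sum_row; apply: eq_bigr => a _.
    by rewrite mxE -eE.
  have [l1 l2 l3 l4 _ _ _ _] := kc.
  rewrite /hol_curv (linear_functional_frame (l1 _ _ _)) /=.
  apply: eq_bigr => a _; rewrite mxE; congr (_ * _).
  rewrite (linear_functional_frame (linear_functional_J0 (l2 _ _ _))).
  apply: eq_bigr => b _; rewrite mxE; congr (_ * _).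
  rewrite (linear_functional_frame (l3 _ _ _)).
  apply: eq_bigr => c _; rewrite mxE; congr (_ * _).
  rewrite (linear_functional_frame (linear_functional_J0 (l4 _ _ _))).
  by apply: eq_bigr => d _; rewrite mxE /K EO.
rewrite /hol_curv_average !sphere_integralE sphere_volume.
rewrite (_ : (fun psi => _) = (fun psi => segment_integral pi (fun theta =>
    segment_integral (2 * pi) (fun phi =>
      let t := sphere_coord psi theta phi in
      (\sum_a t a * \sum_b t b * \sum_c t c * \sum_d t d * K a b c d)
      * (sin psi ^+ 2 * sin theta))))); last first.
  apply/funext => psi; congr segment_integral; apply/funext => theta.
  by congr segment_integral; apply/funext => phi; rewrite H.
(* What remains is (2 pi^2)^-1 (pi^2 / 12) (4 s) = s / 6. *)
rewrite sphere_quartic hol_contraction //.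
have : pi != 0 :> R by rewrite gt_eqF // pi_gt0.
by move: (pi : R) (scalar_curvature g x) => p s p0; field.
Qed.

End Average.

Lemma posdef_unitmx (R : realFieldType) n (G : 'M[R]_n) :
  (forall v : 'rV_n, v != 0 -> 0 < (v *m G *m v^T) 0 0) -> G \in unitmx.
Proof.
move=> pos; rewrite -row_free_unit -kermx_eq0; apply/rowV0P => v /sub_kermxP vG.
apply/eqP; apply: contraT => /pos.
by rewrite vG mul0mx mxE ltxx.
Qed.

Section PointwiseExtrema.
Context (R : realType) (g : 'rV[R]_4 -> 'M[R]_4) (x : 'rV[R]_4) (P : 'M[R]_4).
Context (kc : kahler_curvature (curvature g x)) (gsym : (g x)^T = g x)
  (gunit : g x \in unitmx)
  (Pg : P *m g x *m P^T = 1%:M) (PJ : P *m J0 R = J0 R *m P).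
Let r := frame_curv g x P.
Let s := scalar_curvature g x.
Let B := weyl_mx r s.

(** The rows of [K] are the [asd_mx] coordinates of the given basis. Spanning yields a left inverse
    of [K], and the action of W^- on the basis reads [K *m B = A *m K]. *)
Lemma weyl_minus_matrix l1 l2 l3 : weyl_minus_eigenvalues g x l1 l2 l3 ->
  exists A K : 'M[R]_3, [/\ K \in unitmx, K *m B = A *m K
    & char_poly A = ('X - l1%:P) * ('X - l2%:P) * ('X - l3%:P)].
Proof.
move=> [b [A [[basd bspan] bW chA]]]; have Pu := frame_unit Pg.
have [k kE] := choice (fun a => (frame_anti_self_dual gunit Pg PJ _).1 (basd a)).
pose K : 'M[R]_3 := \matrix_a k a.
have kK a : k a = row a K by rewrite rowK.
have Psum (c : 'rV[R]_3) : P *m (\sum_a c 0 a *: b a) *m P^T = asd_mx (c *m K).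
  rewrite mulmx_sumr mulmx_suml mulmx_sum_row asd_mx_sum.
  by apply: eq_bigr => a _; rewrite -scalemxAr -scalemxAl kE kK.
have span u : exists c : 'rV_3, c *m K = u.
  pose al := invmx P *m asd_mx u *m (invmx P)^T.
  have alE : P *m al *m P^T = asd_mx u.
    by rewrite /al -!mulmxA -trmx_mul mulmxV // trmx1 mulmx1 mulKVmx.
  have [c [alc _]] := bspan al ((frame_anti_self_dual gunit Pg PJ al).2 (ex_intro _ u alE)).
  by exists c; apply: (@asd_mx_inj R); rewrite -Psum -alc.
have [C CE] := choice (fun i => span (row i 1%:M)).
exists A, K; split=> //.
  have : (\matrix_i C i) *m K = 1%:M.
    by apply/row_matrixP => i; rewrite row_mul rowK CE.
  by case/mulmx1_unit.
apply/row_matrixP => a; rewrite !row_mul -kK; apply: (@asd_mx_inj R).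
rewrite -(frame_weyl_minus kc gunit Pg PJ (kE a)) bW -Psum.
by congr (_ *m _ *m _); apply: eq_bigr => c _; rewrite mxE.
Qed.

Lemma hol_curv_hopf c y : ricci g x = c *: g x -> (y *m y^T) 0 0 = 1 ->
  hol_curv g x (y *m P) = s / 6 + (hopf y *m B *m (hopf y)^T) 0 0 / 2.
Proof.
move=> ein y1; have kr := frame_kahler_tensor kc PJ.
rewrite (hol_curv_frame kc PJ); apply: (hol_quartic kr).
- exact: (frame_einstein gsym gunit Pg ein).
- by rewrite -y1 mxE big_ord4 !trmx_entry !expr2.
Qed.

Lemma hol_curv_extrema c l1 l2 l3 : ricci g x = c *: g x ->
  l1 <= l2 -> l2 <= l3 -> weyl_minus_eigenvalues g x l1 l2 l3 ->
  is_maximum (hol_curv_values g x) (s / 6 + l3 / 2) /\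
  is_minimum (hol_curv_values g x) (s / 6 + l1 / 2).
Proof.
move=> ein h12 h23 /weyl_minus_matrix[A [K [Ku KB chA]]].
have kr := frame_kahler_tensor kc PJ.
have Bsym : B^T = B by exact: weyl_mx_sym.
have attained l : root (char_poly A) l -> hol_curv_values g x (s / 6 + l / 2).
  move=> /(quadratic_form_attained Ku KB)[h h1 hB].
  have [y y1 yh] := hopf_surjective h1.
  exists (y *m P); first by rewrite /unit_vector (frame_inner Pg).
  by rewrite (hol_curv_hopf ein y1) yh hB.
have values m : hol_curv_values g x m -> exists2 h : 'rV_3,
    (h *m h^T) 0 0 = 1 & m = s / 6 + (h *m B *m h^T) 0 0 / 2.
  move=> [X X1 <-]; have XE : X = X *m invmx P *m P by rewrite mulmxKV // (frame_unit Pg).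
  have y1 : (X *m invmx P *m (X *m invmx P)^T) 0 0 = 1 by rewrite -(frame_inner Pg) -XE.
  exists (hopf (X *m invmx P)); first by rewrite hopf_norm y1 expr1n.
  by rewrite {1}XE (hol_curv_hopf ein y1).
split; split.
- by apply: attained; rewrite chA rootM root_XsubC eqxx orbT.
- move=> m /values[h h1 ->]; rewrite lerD2l ler_pM2r //.
  exact: (quadratic_form_le Bsym Ku KB chA).
- by apply: attained; rewrite chA !rootM !root_XsubC eqxx.
- move=> m /values[h h1 ->]; rewrite lerD2l ler_pM2r //.
  exact: (quadratic_form_ge Bsym Ku KB chA).
Qed.

End PointwiseExtrema.

Theorem lemma3 (R : realType) (M : topologicalType) (S : complexSurface R M)
    (G : kahlerMetric S) (HE : einstein G)
    (p : M) (i : chart_index S) (hp : chart_dom i p)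
    (l1 l2 l3 : R) (h12 : l1 <= l2) (h23 : l2 <= l3) :
  let g := metric G i in
  let x := chart_map i p in
  let s := scalar_curvature g x in
  weyl_minus_eigenvalues g x l1 l2 l3 ->
  [/\ is_maximum (hol_curv_values g x) (s / 6 + l3 / 2),
      is_minimum (hol_curv_values g x) (s / 6 + l1 / 2)
    & forall e : 'I_4 -> 'rV[R]_4, orthonormal_frame g x e ->
        hol_curv_average g x e = s / 6].
Proof.
move=> g x s eig; have [c /(_ i p hp) ein] := HE.
(* The metric identities are needed on an open set and not only at [x], because the curvature lemmas
   differentiate them. *)
pose U : set 'rV[R]_4 := (chart_map i @` chart_dom i)%classic.
have Ux : U x by exists p.
have gsym y : U y -> (g y)^T = g y by case=> q dq <-; exact: (Defs.metric_sym G).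
have gunit y : U y -> g y \in unitmx.
  by case=> q dq <-; apply: posdef_unitmx => v; exact: (Defs.metric_pos G).
have gherm y : U y -> J0 R *m g y *m (J0 R)^T = g y.
  by case=> q dq <-; exact: (Defs.metric_hermitian G).
have kc : kahler_curvature (curvature g x).
  have Uo : open U by exact: chart_image_open.
  apply: (curvature_kahler Uo) Ux => //.
  - exact: (Defs.metric_smooth G).
  - by move=> y a b d [q dq <-]; exact: (Defs.kahler_form_closed G).
have gpos (v : 'rV[R]_4) : v != 0 -> 0 < (v *m g x *m v^T) 0 0 by exact: (Defs.metric_pos G hp).
have [P [Pg PJ]] := unitary_frame (gsym x Ux) gpos (gherm x Ux).
have [Hmax Hmin] := hol_curv_extrema kc (gsym x Ux) (gunit x Ux) Pg PJ ein h12 h23 eig.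
split=> // e one.
exact: (hol_curv_average_scalar kc (gsym x Ux) (gunit x Ux) Pg PJ one).
Qed.
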